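(* Let $d\ge 2$ and let $\Phi$ be a symmetric linear graph directed Markov system associated to the free group $F_d=\langle g_1,\dots,g_d\rangle$. For every normal subgroup $N$ of $F_d$ we have $$\delta(F_d,\Phi)=\delta(N,\Phi)\quad\text{if and only if}\quad F_d/N \text{ is amenable}.$$
   Context: Let $d\ge2$ and let $F_d=\langle g_1,\dots,g_d\rangle$ be the free group on $g_1,\dots,g_d$. Put $V:=\{g_1,g_1^{-1},\dots,g_d,g_d^{-1}\}$ and $E:=\{(v,w)\in V^2: v\ne w^{-1}\}$. A linear graph directed Markov system (linear GDMS) $\Phi$ associated to $F_d$ consists of nonempty compact sets $X_v\subset\mathbb{R}^D$ ($v\in V$), for some $D\ge1$, and of maps $\phi_{(v,w)}:X_w\to X_v$ ($(v,w)\in E$), each of which is the restriction of a similarity of $\mathbb{R}^D$ with contraction ratio in $(0,1)$, such that: (i) each $X_v$ is connected and equal to the closure of its interior; (ii) (open set condition) for all distinct edges $(v,w)\neq(v',w')$ in $E$, $\phi_{(v,w)}(\mathrm{Int}(X_w))\cap\phi_{(v',w')}(\mathrm{Int}(X_{w'}))=\emptyset$; (iii) (cone property) there exist $l>0$ and $0<\gamma<\pi/2$ such that for each $v\in V$ and $x\in X_v$ there is an open cone with vertex $x$, central angle of measure $\gamma$ and altitude $l$ contained in $\mathrm{Int}(X_v)$; (iv) the contraction ratio of $\phi_{(v,w)}$ is independent of $w$; it is denoted $c_\Phi(v)$. (The remaining conditions in the definition of a conformal GDMS hold automatically for similarities. The edge incidence matrix allows $(v,w)$ to be followed by $(v',w')$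 if and only if $w=v'$.) $\Phi$ is called symmetric if $c_\Phi(g)=c_\Phi(g^{-1})$ for all $g\in V$. Extend $c_\Phi$ to $F_d$ by $c_\Phi(g):=\prod_{i=1}^n c_\Phi(v_i)$, where $v_1\cdots v_n$ is the unique representation of $g$ as a reduced word in elements of $V$ (with $c_\Phi(\mathrm{id})=1$). For a subgroup $H$ of $F_d$, the exponent of convergence is $\delta(H,\Phi):=\inf\{t\ge0:\sum_{h\in H}c_\Phi(h)^t<\infty\}$. *)

(* Defs.v *)
From HB Require Import structures.
From mathcomp Require Import all_boot all_order all_algebra.
From mathcomp Require Import all_classical all_reals all_analysis.

Set Implicit Arguments.
Unset Strict Implicit.
Unset Printing Implicit Defensive.

Import Order.TTheory GRing.Theory Num.Theory.
Import numFieldNormedType.Exports.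

Local Open Scope classical_set_scope.
Local Open Scope ring_scope.

(* (i, true) stands for the generator g_i and (i, false) for its inverse. *)
Definition letter (d : nat) : Type := ('I_d * bool)%type.

HB.instance Definition _ d := Finite.on (letter d).

Definition linv d (v : letter d) : letter d := (v.1, ~~ v.2).

Definition edge d (e : letter d * letter d) : bool := e.1 != linv e.2.

Definition reduced d (s : seq (letter d)) : bool :=
  sorted (fun v w => edge (v, w)) s.

Record free_group (d : nat) : Type := FreeGroup {
  fg_word :> seq (letter d);
  fg_reduced : reduced fg_word }.

HB.instance Definition _ d := [isSub of free_group d for @fg_word d].
HB.instance Definition _ d := [Choice of free_group d by <:].

(* The reduced form of v s, for s reduced. *)
Definition lcons d (v : letter d) (s : seq (letter d)) : seq (letter d) :=
  if s is w :: s' then if edge (v, w) then v :: s else s' else [:: v].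

Section FreeGroup.
Variable d : nat.
Implicit Types (v w : letter d) (s t : seq (letter d)) (g h : free_group d).

Lemma linvK : involutive (@linv d).
Proof. by case=> i b; rewrite /linv /= negbK. Qed.

Lemma edge_sym v w : edge (v, w) = edge (w, v).
Proof. by rewrite /edge /= eq_sym (can2_eq linvK linvK). Qed.

Lemma edge_linv v w : edge (linv v, linv w) = edge (v, w).
Proof. by rewrite /edge /= (inj_eq (inv_inj linvK)). Qed.

Lemma lcons_reduced v s : reduced s -> reduced (lcons v s).
Proof.
case: s => [//|w s] /= rs; case: ifP => [evw|_] /=; first by rewrite evw.
exact: path_sorted rs.
Qed.

Lemma lcons_cons v s : reduced (v :: s) -> lcons v s = v :: s.
Proof. by case: s => [//|w s] /= /andP[->]. Qed.

Lemma lconsK v s : reduced s -> lcons (linv v) (lcons v s) = s.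
Proof.
case: s => [|w s] rs /=; first by rewrite /edge eqxx.
case: ifPn => [_ /=|]; first by rewrite /edge eqxx.
rewrite /edge negbK /= => /eqP vE; rewrite vE linvK.
exact: lcons_cons.
Qed.

Lemma foldr_lcons_reduced s t : reduced t -> reduced (foldr (@lcons d) t s).
Proof. by move=> rt; elim: s => //= v s; exact: lcons_reduced. Qed.

Lemma foldr_lcons v s t : reduced t ->
  foldr (@lcons d) t (lcons v s) = lcons v (foldr (@lcons d) t s).
Proof.
case: s => [//|w s] rt /=; case: ifPn => [//|].
rewrite /edge negbK /= => /eqP ->; rewrite lconsK //.
exact: foldr_lcons_reduced.
Qed.

Lemma foldr_lcons0 s : reduced s -> foldr (@lcons d) [::] s = s.
Proof.
elim: s => [//|v s IHs] rs /=; rewrite IHs ?lcons_cons //.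
exact: path_sorted rs.
Qed.

Definition fg_one : free_group d := FreeGroup (isT : reduced [::]).

Definition fg_mul g h : free_group d :=
  FreeGroup (foldr_lcons_reduced g (fg_reduced h)).

Lemma rev_linv_reduced s : reduced s -> reduced (rev (map (@linv d) s)).
Proof.
rewrite /reduced rev_sorted sorted_map.
rewrite (eq_sorted (e' := fun v w => edge (v, w))) // => v w.
by rewrite /relpre /= edge_linv edge_sym.
Qed.

Definition fg_inv g : free_group d :=
  FreeGroup (rev_linv_reduced (fg_reduced g)).

Lemma fg_mulA : associative fg_mul.
Proof.
move=> g h k; apply: val_inj => /=.
elim: (fg_word g) => [//|v s IHs] /=; rewrite IHs foldr_lcons //.
exact: fg_reduced.
Qed.

Lemma fg_mul1g : left_id fg_one fg_mul.
Proof. by move=> g; apply: val_inj. Qed.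

Lemma fg_mulg1 : right_id fg_one fg_mul.
Proof. by move=> g; apply: val_inj; apply: foldr_lcons0 (fg_reduced g). Qed.

Lemma fg_invK : involutive fg_inv.
Proof.
by move=> g; apply: val_inj; rewrite /= map_rev revK (mapK linvK).
Qed.

Lemma fg_mulVg : left_inverse fg_one fg_inv fg_mul.
Proof.
move=> g; apply: val_inj => /=; case: g => s /= rs.
elim: s rs => [//|v s IHs] rs /=.
have rs' : reduced s := path_sorted rs.
by rewrite rev_cons foldr_rcons -(lcons_cons rs) lconsK // IHs.
Qed.

Lemma fg_mulgV : right_inverse fg_one fg_inv fg_mul.
Proof. by move=> g; rewrite -{1}(fg_invK g) fg_mulVg. Qed.

HB.instance Definition _ :=
  isGroup.Build (free_group d) fg_mulA fg_mul1g fg_mulg1 fg_mulVg fg_mulgV.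

End FreeGroup.

Record normal_subgroup (G : groupType) : Type := NormalSubgroup {
  ns_set :> set G;
  ns_one : ns_set 1%g;
  ns_mul : forall x y, ns_set x -> ns_set y -> ns_set (x * y)%g;
  ns_inv : forall x, ns_set x -> ns_set (x^-1)%g;
  ns_conj : forall x y, ns_set x -> ns_set (x ^ y)%g }.

Section Quotient.
Variables (G : groupType) (N : normal_subgroup G).
Local Open Scope group_scope.
Local Open Scope quotient_scope.

Definition coset_eq (x y : G) : bool := `[< ns_set N (x^-1 * y)%g >].

Lemma coset_eq_refl : reflexive coset_eq.
Proof. by move=> x; apply/asboolP; rewrite mulVg; exact: ns_one. Qed.

Lemma coset_eq_sym : symmetric coset_eq.
Proof.
by move=> x y; apply/asboolP/asboolP => /ns_inv; rewrite invgM invgK.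
Qed.

Lemma coset_eq_trans : transitive coset_eq.
Proof.
move=> y x z /asboolP xy /asboolP yz; apply/asboolP.
by have := ns_mul xy yz; rewrite -mulgA mulVKg.
Qed.

Canonical coset_equiv :=
  EquivRel coset_eq coset_eq_refl coset_eq_sym coset_eq_trans.

Definition quotient_group : Type := {eq_quot coset_eq}.

HB.instance Definition _ := Choice.on quotient_group.
HB.instance Definition _ := EqQuotient.on quotient_group.

Definition quotient_proj (x : G) : quotient_group := \pi_(quotient_group) x.

Definition quotient_one : quotient_group := quotient_proj 1.
Definition quotient_mul (a b : quotient_group) : quotient_group :=
  quotient_proj (repr a * repr b).
Definition quotient_inv (a : quotient_group) : quotient_group :=
  quotient_proj ((repr a)^-1).

Lemma quotient_projW (P : quotient_group -> Prop) :
  (forall x, P (quotient_proj x)) -> forall a, P a.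
Proof. exact: quotW. Qed.

Lemma eq_proj (x y : G) : ns_set N (x^-1 * y) -> quotient_proj x = quotient_proj y.
Proof. by move=> xy; apply/(eqmodP coset_equiv)/asboolP. Qed.

Lemma repr_proj (x : G) : ns_set N ((repr (quotient_proj x))^-1 * x).
Proof.
have /(eqmodP coset_equiv)/asboolP// :
  quotient_proj (repr (quotient_proj x)) = quotient_proj x.
exact: reprK.
Qed.

Lemma quotient_mulE (x y : G) :
  quotient_mul (quotient_proj x) (quotient_proj y) = quotient_proj (x * y).
Proof.
apply: eq_proj; set x' := repr _; set y' := repr _.
have Nx : ns_set N (x'^-1 * x) := repr_proj x.
have Ny : ns_set N (y'^-1 * y) := repr_proj y.
have := ns_mul (ns_conj y' Nx) Ny.
by rewrite conjgE invgM !mulgA mulgK.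
Qed.

Lemma quotient_invE (x : G) : quotient_inv (quotient_proj x) = quotient_proj (x^-1).
Proof.
apply: eq_proj; set x' := repr _; rewrite invgK.
have Nx : ns_set N (x'^-1 * x) := repr_proj x.
have := ns_conj (x'^-1) (ns_inv Nx).
by rewrite conjgE invgM !invgK !mulgA mulgK.
Qed.

Lemma quotient_mulA : associative quotient_mul.
Proof.
elim/quotient_projW=> x; elim/quotient_projW=> y; elim/quotient_projW=> z.
by rewrite !quotient_mulE mulgA.
Qed.

Lemma quotient_mul1g : left_id quotient_one quotient_mul.
Proof. by elim/quotient_projW=> x; rewrite quotient_mulE mul1g. Qed.

Lemma quotient_mulg1 : right_id quotient_one quotient_mul.
Proof. by elim/quotient_projW=> x; rewrite quotient_mulE mulg1. Qed.

Lemma quotient_mulVg : left_inverse quotient_one quotient_inv quotient_mul.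
Proof. by elim/quotient_projW=> x; rewrite quotient_invE quotient_mulE mulVg. Qed.

Lemma quotient_mulgV : right_inverse quotient_one quotient_inv quotient_mul.
Proof. by elim/quotient_projW=> x; rewrite quotient_invE quotient_mulE mulgV. Qed.

HB.instance Definition _ := isGroup.Build quotient_group
  quotient_mulA quotient_mul1g quotient_mulg1 quotient_mulVg quotient_mulgV.

End Quotient.

(* Von Neumann's definition: a left-invariant finitely additive probability
   measure on all subsets of the discrete group G. *)
Definition amenable (R : realType) (G : groupType) : Prop :=
  exists mu : set G -> R,
    [/\ forall A, 0 <= mu A,
        mu setT = 1,
        forall A B, A `&` B = set0 -> mu (A `|` B) = mu A + mu B &
        forall (g : G) A, mu [set (g * x)%g | x in A] = mu A].

Section Euclidean.
Variables (R : realType) (D : nat).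
Implicit Types x y u : 'rV[R]_D.

Definition edot x y : R := \sum_(i < D) x 0 i * y 0 i.

(* The library norm on 'rV[R]_D is the sup norm (same topology). *)
Definition enorm x : R := Num.sqrt (edot x x).

Definition similarity (c : R) (f : 'rV[R]_D -> 'rV[R]_D) : Prop :=
  forall x y, enorm (f x - f y) = c * enorm (x - y).

(* Vertex x, axis the unit vector u, altitude l measured along the axis;
   gamma is the angle between the axis and the lateral surface. *)
Definition open_cone x u (gamma l : R) : set 'rV[R]_D :=
  [set y | enorm (y - x) * cos gamma < edot (y - x) u < l].

End Euclidean.

(* gdms_map e, for e = (v, w), is a map of the whole space: phi_e is its
   restriction to X_w, and its values at non-edges e are irrelevant. *)
Record linear_gdms (R : realType) (d : nat) : Type := LinearGDMS {
  gdms_dim : nat;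
  gdms_set : letter d -> set 'rV[R]_gdms_dim;
  gdms_map : letter d * letter d -> 'rV[R]_gdms_dim -> 'rV[R]_gdms_dim;
  gdms_ratio : letter d -> R;
  gdms_dim_ge1 : (1 <= gdms_dim)%N;
  gdms_nonempty : forall v, gdms_set v !=set0;
  gdms_compact : forall v, compact (gdms_set v);
  gdms_map_sub : forall e, edge e ->
    gdms_map e @` gdms_set e.2 `<=` gdms_set e.1;
  gdms_ratio_gt0 : forall v, 0 < gdms_ratio v;
  gdms_ratio_lt1 : forall v, gdms_ratio v < 1;
  gdms_similarity : forall e, edge e ->
    similarity (gdms_ratio e.1) (gdms_map e);
  gdms_connected : forall v, connected (gdms_set v);
  gdms_regular : forall v, gdms_set v = closure (interior (gdms_set v));
  gdms_open_set_condition : forall e e', edge e -> edge e' -> e != e' ->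
    gdms_map e @` interior (gdms_set e.2) `&`
    gdms_map e' @` interior (gdms_set e'.2) = set0;
  gdms_cone_property : exists l gamma : R,
    [/\ 0 < l, 0 < gamma, gamma < pi / 2 &
      forall v x, gdms_set v x -> exists2 u, enorm u = 1 &
        open_cone x u gamma l `<=` interior (gdms_set v)] }.

Section Exponent.
Variables (R : realType) (d : nat) (Phi : linear_gdms R d).

Definition symmetric_gdms : Prop :=
  forall v, gdms_ratio Phi v = gdms_ratio Phi (linv v).

Definition word_ratio (g : free_group d) : R :=
  \prod_(v <- fg_word g) gdms_ratio Phi v.

Definition exponent_of_convergence (H : set (free_group d)) : \bar R :=
  ereal_inf [set t%:E | t in [set t : R | 0 <= t /\
    (\esum_(h in H) (word_ratio h `^ t)%:E < +oo)%E]].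

End Exponent.

(* Main.v *)
Require Import Defs.
From mathcomp Require Import all_boot all_order all_algebra.
From mathcomp Require Import all_classical all_reals all_analysis.
From mathcomp Require Import finmap zify ring lra.

(** Fix t > 0 and put x_v = c(v)^t. The series that defines the exponent of a
    subgroup H is the sum over H of the weights x_g, where x_g is the product
    of the x_v along the reduced word g.

    The key fact is that g |-> x_g is a Green function on the free group. With
    j_v = x_v / (1 - x_v^2) and k = 1 - sum_v x_v / (1 + x_v),
      (k + sum_v j_v) x_g = [g = 1] + sum_v j_v x_(v^-1 g)
    for all g ([weight_green]): v^-1 g has one letter less than g if v is the
    first letter of g, and one letter more otherwise. Hence the sum r(y) of the
    x_g over the elements g of the coset y solves L r = [y = 1] on the
    quotient G = F_d / N, where
      L f (y) = k f(y) + sum_v j_v (f(y) - f(v^-1 y))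
    is the generator of a symmetric nearest-neighbour walk with killing rate k.
    Summing over G shows that the series of F_d converges exactly when k > 0
    ([mass1_lty]); as k increases with t, its sign changes at delta(F_d).

    Suppose that G is amenable and that the series of N, which is r(1),
    converges. Then r is finite and positive and L r >= 0, so log u <= u - 1
    bounds the drift sum_v j_v (log r(v y) - log r(y)) by k at every y. The
    increments of log r are bounded, and an invariant mean of the drift is 0
    because v and v^-1 have the same rate. Therefore k >= 0
    ([amenable_killing_ge0]), and t is at least delta(F_d).

    Suppose that G is not amenable. Then the Dirichlet form of G has a gap,
    since otherwise the squares of almost invariant functions accumulate at an
    invariant measure ([amenable_of_almost_invariant]). The gap bounds the
    convolution by r on l^2(G), by a constant K that is the same for all t in a
    right neighbourhood of delta(F_d) ([energy_spread]). A reduced word of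
    length n splits into a prefix and a suffix in n + 1 ways, so the push-forward
    w to G of (1 + z)^|g| x_g is at most the convolution of [y = 1] + z w by r
    ([boosted_le]). For small z the l^2 bound then controls w, and the sum of
    (1 + z)^|g| x_g over N converges ([kernel_growth]). The factor (1 + z)^|g|
    pays for lowering t by an amount that depends only on z and on the ratios,
    so the series of N converges somewhere below delta(F_d). *)

Set Implicit Arguments.
Unset Strict Implicit.
Unset Printing Implicit Defensive.

Import Order.TTheory GRing.Theory Num.Theory.
Import numFieldNormedType.Exports.

Local Open Scope classical_set_scope.
Local Open Scope ring_scope.

(** * Sums of nonnegative extended reals *)

Section EsumComplements.
Variable R : realType.
Local Open Scope ereal_scope.

Lemma esumZl (T : choiceType) (D : set T) (c : R) (a : T -> \bar R) :
  (0 <= c)%R -> (forall i, 0 <= a i) ->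
  \esum_(i in D) (c%:E * a i) = c%:E * \esum_(i in D) a i.
Proof.
move=> c0 a0; rewrite /esum -ereal_supZl//; last first.
  by apply/set0P; exists (\sum_(x \in set0) a x), set0 => //; exact: fsets_set0.
rewrite image_comp; congr ereal_sup; apply: eq_imagel => X _ /=.
by rewrite ge0_mule_fsumr.
Qed.

Lemma esum_exchange (T1 T2 : choiceType) (a : T1 -> T2 -> \bar R) :
  (forall i j, 0 <= a i j) ->
  \esum_(i in [set: T1]) \esum_(j in [set: T2]) a i j =
  \esum_(j in [set: T2]) \esum_(i in [set: T1]) a i j.
Proof.
move=> a0; rewrite !esum_esum//.
rewrite (reindex_esum ([set: T2] `*`` fun=> [set: T1]) _ (fun k => (k.2, k.1)))//.
split=> //=.
- by move=> [i j] [i' j'] _ _ [-> ->].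
- by move=> [i j] _; exists (j, i).
Qed.

Lemma esum_ge_term (T : choiceType) (a : T -> \bar R) (i : T) :
  (forall i, 0 <= a i) -> a i <= \esum_(j in [set: T]) a j.
Proof.
move=> a0; apply: esum_ge; exists [set i]; last by rewrite fsbig_set1.
by split => //; exact: finite_set1.
Qed.

Lemma esum_mulg (G : groupType) (g : G) (a : G -> \bar R) :
  \esum_(y in [set: G]) a (g * y)%g = \esum_(y in [set: G]) a y.
Proof.
rewrite [RHS](reindex_esum [set: G] [set: G] (fun y => (g * y)%g))//; split=> //.
- by move=> y z _ _; exact: mulgI.
- by move=> y _; exists (g^-1 * y)%g => //; rewrite mulVKg.
Qed.

Lemma esum_delta (T : choiceType) (i : T) (a : T -> R) : (0 <= a i)%R ->
  \esum_(j in [set: T]) ((j == i)%:R * a j)%:E = (a i)%:E.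
Proof.
move=> a0; rewrite -[RHS](@esum_set1 _ _ i (fun j => (a j)%:E)) ?lee_fin//.
rewrite [RHS]esum_mkcond; apply: eq_esum => j _.
have [->|ji] := eqVneq j i; first by rewrite mul1r mem_set.
by rewrite mul0r memNset// => /eqP; rewrite (negPf ji).
Qed.

End EsumComplements.

Lemma ler_sum_sub (R : numDomainType) (T : eqType) (r s : seq T) (F : T -> R) :
  (forall i, 0 <= F i) -> uniq r -> {subset r <= s} ->
  \sum_(i <- r) F i <= \sum_(i <- s) F i.
Proof.
move=> F0; elim: r s => [|a r IHr] s /=; first by rewrite big_nil sumr_ge0.
case/andP=> ar ur rs; have sa : a \in s by apply: rs; rewrite mem_head.
rewrite big_cons (perm_big _ (perm_to_rem sa))/= big_cons lerD2l.
apply: IHr => // i ir; have : i \in a :: rem a s.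
  by rewrite -(perm_mem (perm_to_rem sa)) rs// inE ir orbT.
by rewrite inE => /predU1P[ia|//]; rewrite -ia ir in ar.
Qed.

(** * Weighted words as a Green function *)

Section Weights.
Variables (R : realType) (d : nat) (x : letter d -> R).
Hypotheses (x_gt0 : forall v, 0 < x v) (x_lt1 : forall v, x v < 1)
  (x_sym : forall v, x (linv v) = x v).
Implicit Types (v w : letter d) (s : seq (letter d)) (g h : free_group d).

Definition gen v : free_group d := FreeGroup (isT : reduced [:: v]).

Lemma gen_linv v : gen (linv v) = (gen v)^-1%g.
Proof. exact: val_inj. Qed.

Lemma free_group_ind (P : free_group d -> Prop) :
  P 1%g -> (forall v g, P g -> P (gen v * g)%g) -> forall g, P g.
Proof.
move=> P1 PM [s]; elim: s => [|v s IHs] rs.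
  by rewrite (_ : FreeGroup _ = 1%g)//; exact: val_inj.
have rs' : reduced s := path_sorted rs.
rewrite (_ : FreeGroup rs = gen v * FreeGroup rs')%g; first exact/PM/IHs.
by apply: val_inj; rewrite /= lcons_cons.
Qed.

Definition weight s : R := \prod_(v <- s) x v.

Lemma weight_gt0 s : 0 < weight s.
Proof. by apply: prodr_gt0 => v _. Qed.

Lemma weight_ge0 s : 0 <= weight s. Proof. exact/ltW/weight_gt0. Qed.

(** If [killing] is positive, the walk on the free group that jumps at these rates
    and is killed at the rate [killing] has probability x v of ever reaching the
    letter v from 1. *)
Definition jump v : R := x v / (1 - x v ^+ 2).
Definition killing : R := 1 - \sum_v x v / (1 + x v).
Definition total_rate : R := killing + \sum_v jump v.

Lemma onem_sqr_gt0 v : 0 < 1 - x v ^+ 2.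
Proof. by rewrite subr_gt0 expr_lt1 ?ltW ?x_lt1. Qed.

Lemma jump_gt0 v : 0 < jump v.
Proof. by rewrite divr_gt0 ?onem_sqr_gt0. Qed.

Lemma jump_linv v : jump (linv v) = jump v.
Proof. by rewrite /jump x_sym. Qed.

Lemma le_jump v : x v <= jump v.
Proof.
rewrite ler_pdivlMr ?onem_sqr_gt0// ler_piMr ?(ltW (x_gt0 v))//.
by rewrite lerBlDr lerDl sqr_ge0.
Qed.

Lemma total_rateE : total_rate = 1 + \sum_v jump v * x v.
Proof.
rewrite /total_rate /killing -addrA; congr (_ + _).
rewrite addrC -sumrB; apply: eq_bigr => v _; rewrite /jump.
have := onem_sqr_gt0 v; have := x_gt0 v => x0 s0.
by field; apply/andP; split; apply: lt0r_neq0 => //; lra.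
Qed.

Lemma total_rate_gt0 : 0 < total_rate.
Proof.
rewrite total_rateE ltr_pwDl// sumr_ge0// => v _.
by rewrite mulr_ge0// ltW// jump_gt0.
Qed.

(** Deleting the first letter w of g divides the weight by x w, and any other
    letter v put in front multiplies it by x v. The rates are chosen so that
    jump w / x w - jump w * x w = 1, which makes the sum independent of w. *)
Lemma weight_green g :
  total_rate * weight g =
  (g == 1%g)%:R + \sum_v jump v * weight (gen (linv v) * g)%g.
Proof.
rewrite total_rateE.
case: g => -[|w s] rs; rewrite -val_eqE /=.
  rewrite /weight big_nil mulr1; congr (_ + _); apply: eq_bigr => v _.
  by rewrite big_seq1 x_sym.
rewrite add0r (bigD1 w)//= [in RHS](bigD1 w)//=.
rewrite /edge/= eqxx /= /weight !big_cons -/(weight s).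
have -> : \sum_(v | v != w) jump v * \prod_(u <- if linv v != linv w then
    [:: linv v, w & s] else s) x u =
    (\sum_(v | v != w) jump v * x v) * (x w * weight s).
  rewrite mulr_suml; apply: eq_bigr => v vw.
  rewrite (inj_eq (inv_inj (@linvK d))) vw !big_cons x_sym -/(weight s).
  by rewrite mulrA.
rewrite addrA mulrDl; congr (_ + _).
have := onem_sqr_gt0 w; rewrite /jump => /lt0r_neq0 s0.
by field.
Qed.

Definition mass (phi : free_group d -> R) : \bar R :=
  \esum_(g in [set: free_group d]) (weight g * phi g)%:E.

Lemma mass_ge0 (phi : free_group d -> R) :
  (forall g, 0 <= phi g) -> (0 <= mass phi)%E.
Proof.
by move=> phi0; apply: esum_ge0 => g _; rewrite lee_fin mulr_ge0 ?weight_ge0.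
Qed.

(** The Green identity in dual form. It holds in [0, +oo], so that it also
    serves when the total mass of the weights is infinite. *)
Lemma mass_green (phi : free_group d -> R) : (forall g, 0 <= phi g) ->
  (total_rate%:E * mass phi = (phi 1%g)%:E +
    \sum_v (jump v)%:E * mass (fun g => phi (gen v * g)%g))%E.
Proof.
move=> phi0; have w0 := weight_ge0.
have j0 v : 0 <= jump v := ltW (jump_gt0 v).
rewrite -esumZl ?(ltW total_rate_gt0)//; last first.
  by move=> g; rewrite lee_fin mulr_ge0.
under eq_esum => g _.
  rewrite -EFinM mulrA weight_green mulrDl EFinD mulr_suml -sumEFin.
  over.
rewrite esumD => [||g _]; last first.
- by apply: sume_ge0 => v _; rewrite lee_fin mulr_ge0// mulr_ge0//.
- by move=> g _; rewrite lee_fin mulr_ge0.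
rewrite esum_delta// esum_sum => [|g v _ _]; last first.
  by rewrite lee_fin mulr_ge0// mulr_ge0.
congr (_ + _)%E; apply: eq_bigr => v _.
rewrite /mass -esumZl// => [|g]; last by rewrite lee_fin mulr_ge0.
rewrite -(esum_mulg (gen v)); apply: eq_esum => g _.
by rewrite gen_linv mulKg -EFinM mulrA.
Qed.

(** The continuations s, of length at most n, of a reduced word ending in v. *)
Fixpoint words n v : seq (seq (letter d)) :=
  if n is m.+1 then
    [::] :: [seq w :: s | w <- [seq w <- enum {: letter d} | edge (v, w)],
                          s <- words m w]
  else [:: [::]].

Lemma mem_words n v s : reduced (v :: s) -> (size s <= n)%N -> s \in words n v.
Proof.
elim: n v s => [|n IHn] v [|w s]//=; rewrite inE//= => /andP[vw rs] sn.
apply/allpairsPdep; exists w, s; split=> //; last exact: IHn.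
by rewrite mem_filter vw mem_enum.
Qed.

Lemma words_cons_bound n w : 0 < killing ->
  \sum_(s <- words n w) weight s <= (1 - x w / (1 + x w)) / killing ->
  \sum_(s <- words n w) weight (w :: s) <= x w / (1 + x w) / killing.
Proof.
move=> k0 le_w; under eq_bigr do rewrite /weight big_cons -/(weight _).
rewrite -mulr_sumr (le_trans (ler_wpM2l (ltW (x_gt0 w)) le_w))//.
rewrite mulrA ler_pM2r ?invr_gt0//.
have x0 := x_gt0 w; rewrite le_eqVlt; apply/orP; left; apply/eqP.
by field; apply: lt0r_neq0; lra.
Qed.

(** The right-hand side is the sum over all continuations of v: it is the
    solution m of m v = 1 + sum_w x w * m w, over the w that may follow v. *)
Lemma words_bound n v : 0 < killing ->
  \sum_(s <- words n v) weight s <= (1 - x v / (1 + x v)) / killing.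
Proof.
move=> k0; elim: n v => [|n IHn] v /=.
  rewrite big_seq1 /weight big_nil ler_pdivlMr// mul1r.
  rewrite /killing lerB// (bigD1 v)//= lerDl sumr_ge0// => w _.
  by rewrite divr_ge0 ?addr_ge0// ltW.
rewrite big_cons big_allpairs_dep big_filter big_enum_cond /weight big_nil.
have le_w w (_ : edge (v, w)) := words_cons_bound k0 (IHn w).
apply: le_trans (lerD (lexx 1) (ler_sum _ le_w)) _.
rewrite -mulr_suml ler_pdivlMr// mulrDl mulrVK ?unitfE ?gt_eqF// mul1r.
rewrite {1}/killing (bigID (fun w => edge (v, w)))/=.
rewrite (big_pred1 (linv v) (P := fun w => ~~ edge (v, w))) => [|w].
  by rewrite x_sym; lra.
by rewrite /edge/= negbK eq_sym (can2_eq (@linvK d) (@linvK d)).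
Qed.

(** The total mass m satisfies killing * m = 1 if it is finite; conversely
    [words_bound] bounds its partial sums. *)
Lemma mass1_lty : (mass (fun=> 1%R) < +oo)%E <-> 0 < killing.
Proof.
have m0 : (0 <= mass (fun=> 1%R))%E by apply: mass_ge0 => _; exact: ler01.
split=> [fin|k0].
  have mfin : mass (fun=> 1%R) \is a fin_num by rewrite ge0_fin_numE.
  have := mass_green (fun=> ler01); rewrite -(fineK mfin).
  under [in RHS]eq_bigr do rewrite -EFinM.
  rewrite sumEFin -EFinM -EFinD -mulr_suml => -[] /eqP.
  rewrite -subr_eq -mulrBl /total_rate addrK => /eqP kE.
  rewrite -(@pmulr_lgt0 _ (fine (mass (fun=> 1%R)))) ?kE//.
  rewrite lt_neqAle fine_ge0// andbT eq_sym; apply: contra_eq_neq kE => ->.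
  by rewrite mulr0 eq_sym oner_neq0.
apply: (@le_lt_trans _ _ (killing^-1)%:E); last exact: ltry.
apply: ge_ereal_sup => _ [X [finX _] <-].
rewrite fsbig_finite//= sumEFin lee_fin.
pose n := (\max_(g <- (fset_set X : seq (free_group d))) size (fg_word g))%N.
pose L := [::] :: [seq w :: s | w <- enum {: letter d}, s <- words n w].
under eq_bigr do rewrite mulr1.
rewrite -(big_map (@fg_word d) xpredT weight).
apply: (@le_trans _ _ (\sum_(s <- L) weight s)).
  apply: ler_sum_sub => [s||s /mapP[g gX ->]]; first exact: weight_ge0.
    by rewrite map_inj_uniq ?fset_uniq//; exact: val_inj.
  have : (size (fg_word g) <= n)%N by exact: leq_bigmax_seq.
  case: g {s gX} => -[|w s]//= rs sn; rewrite inE; apply/orP; right.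
  apply/allpairsPdep; exists w, s; rewrite mem_enum; split=> //.
  by rewrite mem_words// ltnW.
rewrite big_cons big_allpairs_dep big_enum/= /weight big_nil.
have le_w w : \sum_(s <- words n w) \prod_(u <- w :: s) x u <=
    x w / (1 + x w) / killing by exact/words_cons_bound/words_bound.
apply: le_trans (lerD (lexx 1) (ler_sum _ (fun w _ => le_w w))) _.
rewrite -mulr_suml -[leRHS]mul1r ler_pdivlMr// mulrDl mulrVK ?unitfE ?gt_eqF//.
by rewrite /killing; lra.
Qed.

End Weights.

(** * Almost invariant functions and amenability *)

Section UltraLimit.
Variables (R : realType) (U : set_system nat).
Hypothesis UU : UltraFilter U.

(** An ultrafilter decides between a neighbourhood of a cluster point and its
    complement, so a cluster point is a limit. *)
Lemma ultra_bounded_cvg (u : nat -> R) (a b : R) :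
  (forall n, a <= u n <= b) -> exists l : R, u @ U --> l.
Proof.
move=> uab; have uI : (u @ U) [set` `[a, b]].
  by apply: nearW => n /=; rewrite in_itv/=.
have [l [_ cl]] := segment_compact (fmap_proper_filter u ultra_proper) uI.
exists l => B Bl; have [//|UB] := in_ultra_setVsetC (u @^-1` B) UU.
by have [y []] := cl _ _ (UB : (u @ U) (~` B)) Bl.
Qed.

End UltraLimit.

Section AlmostInvariant.
Variables (R : realType) (G : groupType) (V : finType) (s : V -> G).
Hypothesis gen_s : forall P : G -> Prop,
  P 1%g -> (forall v y, P y -> P (s v * y)%g) -> forall y, P y.

Definition energy (f : G -> R) : \bar R :=
  \esum_(y in [set: G]) (f y ^+ 2)%:E.
Definition dirichlet (f : G -> R) : \bar R :=
  (\sum_v \esum_(y in [set: G]) ((f (s v * y)%g - f y) ^+ 2)%:E)%E.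

Lemma energy_ge0 f : (0 <= energy f)%E.
Proof. by apply: esum_ge0 => y _; rewrite lee_fin sqr_ge0. Qed.

Lemma energy_lty f : (forall y, 0 <= f y) ->
  (\esum_(y in [set: G]) (f y)%:E < +oo)%E -> (energy f < +oo)%E.
Proof.
move=> f0 finf; pose S := \esum_(y in [set: G]) (f y)%:E.
have S0 : (0 <= S)%E by apply: esum_ge0 => y _; rewrite lee_fin.
have SE : S = (fine S)%:E by rewrite fineK// ge0_fin_numE.
apply: (@le_lt_trans _ _ ((fine S)%:E * S)%E); last first.
  by rewrite lte_mul_pinfty// lee_fin fine_ge0.
rewrite -esumZl ?fine_ge0//.
apply: le_esum => y _; rewrite -EFinM lee_fin expr2 ler_wpM2r//.
rewrite -lee_fin -SE; apply: (@esum_ge_term _ _ (fun y => (f y)%:E)) => z.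
by rewrite lee_fin.
Qed.

Lemma dirichlet_ge0 f : (0 <= dirichlet f)%E.
Proof.
by apply: sume_ge0 => v _; apply: esum_ge0 => y _; rewrite lee_fin sqr_ge0.
Qed.

(** How far the measure with density f^2 is from being invariant under s v.
    Young's inequality with a free parameter k avoids square roots: the k is sent
    to 0 after the Dirichlet form. *)
Lemma energy_translate f (k : R) v (A : set G) : 0 < k ->
  (\esum_(y in [set (s v * y)%g | y in A]) (f y ^+ 2)%:E <=
   (1 + k)%:E * (\esum_(y in A) (f y ^+ 2)%:E) +
   (1 + k^-1)%:E * dirichlet f)%E.
Proof.
move=> k0; have ki0 : 0 < k^-1 by rewrite invr_gt0.
have sq (y : G) : (0%:E <= (f y ^+ 2)%:E)%E by rewrite lee_fin sqr_ge0.
have sqB (y : G) : (0%:E <= ((f (s v * y)%g - f y) ^+ 2)%:E)%E.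
  by rewrite lee_fin sqr_ge0.
rewrite (esum_image A (fun y => (s v * y)%g)); last first.
  by move=> y z _ _; exact: mulgI.
have young (a b : R) : a ^+ 2 <= (1 + k) * b ^+ 2 + (1 + k^-1) * (a - b) ^+ 2.
  rewrite -subr_ge0.
  have -> : (1 + k) * b ^+ 2 + (1 + k^-1) * (a - b) ^+ 2 - a ^+ 2 =
            k^-1 * (k * b - (a - b)) ^+ 2 by field; exact: lt0r_neq0.
  by rewrite mulr_ge0 ?sqr_ge0// ltW.
apply: (@le_trans _ _ (\esum_(y in A) ((1 + k)%:E * (f y ^+ 2)%:E +
    (1 + k^-1)%:E * ((f (s v * y)%g - f y) ^+ 2)%:E))%E).
  by apply: le_esum => y _; rewrite -!EFinM -EFinD lee_fin young.
have k1 : 0 <= 1 + k by rewrite addr_ge0// ltW.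
have ki1 : 0 <= 1 + k^-1 by rewrite addr_ge0// ltW.
rewrite esumD; try by move=> y _; rewrite mule_ge0// lee_fin.
rewrite !esumZl// leeD2l// lee_wpmul2l ?lee_fin//.
rewrite /dirichlet (bigD1 v)//= -[leLHS]adde0 leeD//.
  rewrite esum_mkcond; apply: le_esum => y _; case: ifP => // _; exact: sqB.
by apply: sume_ge0 => w _; apply: esum_ge0 => y _; rewrite lee_fin sqr_ge0.
Qed.

(** An invariant measure is obtained as the limit, along an ultrafilter, of the
    probability measures with density f_n^2 / energy f_n, where the Dirichlet
    quotient of f_n tends to 0. *)
Lemma amenable_of_almost_invariant :
  (forall e : R, 0 < e -> exists f : G -> R,
    (energy f < +oo)%E /\ (dirichlet f < e%:E * energy f)%E) -> amenable R G.
Proof.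
move=> ex; have /choice[f fP] : forall n, exists f : G -> R,
    (energy f < +oo)%E /\ (dirichlet f < (harmonic n)%:E * energy f)%E.
  by move=> n; apply: ex; exact: harmonic_gt0.
have [U [UU sU]] := @ultraFilterLemma nat \oo%classic _.
pose m n := fine (energy (f n)).
have mE n : energy (f n) = (m n)%:E.
  by rewrite fineK// ge0_fin_numE ?energy_ge0//; case: (fP n).
have m0 n : 0 < m n.
  have [_] := fP n; rewrite mE -EFinM => /(le_lt_trans (dirichlet_ge0 _)).
  by rewrite lte_fin pmulr_rgt0// harmonic_gt0.
pose S n (A : set G) : \bar R := \esum_(y in A) (f n y ^+ 2)%:E.
have sq n (y : G) : (0%:E <= (f n y ^+ 2)%:E)%E by rewrite lee_fin sqr_ge0.
have S0 n A : (0 <= S n A)%E by apply: esum_ge0.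
have Sm n A : (S n A <= (m n)%:E)%E.
  rewrite -mE /S /energy esum_mkcond; apply: le_esum => y _.
  by case: ifP => // _; exact: sq.
have Sfin n A : S n A \is a fin_num.
  by rewrite ge0_fin_numE// (le_lt_trans (Sm n A))// ltry.
pose p (A : set G) n : R := fine (S n A) / m n.
have p01 A n : 0 <= p A n <= 1.
  rewrite /p divr_ge0 ?(ltW (m0 n)) ?fine_ge0//= ler_pdivrMr// mul1r.
  by rewrite -lee_fin fineK.
have /choice[mu muP] : forall A, exists l : R, p A @ U --> l.
  by move=> A; exact: ultra_bounded_cvg (p01 A).
have mu_uniq A (l : R) : p A @ U --> l -> mu A = l.
  by move=> pl; exact: (cvg_unique (@Rhausdorff R) (muP A) pl).
have mu_gen v A : mu [set (s v * y)%g | y in A] <= mu A.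
  apply/ler_addgt0Pr => k k0.
  have cv : (fun n => p A n + (k + (1 + k^-1) * harmonic n)) @ U -->
      mu A + (k + (1 + k^-1) * 0).
    apply: cvgD; first exact: muP.
    apply: cvgD; first exact: cvg_cst.
    apply: cvgM; first exact: cvg_cst.
    by apply: cvg_trans (@cvg_harmonic R); exact: cvg_app.
  rewrite mulr0 addr0 in cv.
  apply: (ler_cvg_to (muP _) cv); apply: nearW => n.
  have := energy_translate (f n) v A k0; rewrite -!/(S _ _) => le1.
  have [_ /ltW le2] := fP n.
  have k1 : 0 <= 1 + k^-1 by rewrite addr_ge0// invr_ge0 ltW.
  have {le1 le2} : (S n [set (s v * y)%g | y in A] <= (1 + k)%:E * S n A +
      (1 + k^-1)%:E * ((harmonic n)%:E * energy (f n)))%E.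
    by apply: le_trans le1 _; rewrite leeD2l// lee_wpmul2l ?lee_fin.
  rewrite mE -(fineK (Sfin _ A)) -(fineK (Sfin _ (image _ _))) -!EFinM -EFinD.
  rewrite lee_fin => le3; rewrite {1}/p ler_pdivrMr//.
  have /andP[_] := p01 A n; have : fine (S n A) = p A n * m n.
    by rewrite /p mulfVK// gt_eqF.
  move=> Sp; rewrite {}Sp in le3; move=> pA1.
  have : k * m n * p A n <= k * m n.
    by rewrite ler_piMr// mulr_ge0// ltW.
  by move: le3; rewrite /harmonic; lra.
have mu_le g A : mu [set (g * y)%g | y in A] <= mu A.
  elim/gen_s: g A => [|v y IHy] A.
    by rewrite (_ : image _ _ = A)//; under eq_imagel do rewrite mul1g; rewrite image_id.
  rewrite (_ : image _ _ = [set (s v * z)%g | z in [set (y * z)%g | z in A]]).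
    exact: le_trans (mu_gen _ _) (IHy _).
  by rewrite image_comp; apply: eq_imagel => z _ /=; rewrite mulgA.
exists mu; split.
- by move=> A; apply: (cvgr_to_ge (muP A)); apply: nearW => n; case/andP: (p01 A n).
- apply: mu_uniq; rewrite (_ : p setT = cst 1); first exact: cvg_cst.
  by apply/funext => n; exact: divff (lt0r_neq0 (m0 n)).
- move=> A B AB0; apply: mu_uniq.
  rewrite (_ : p _ = p A \+ p B); first by apply: cvgD; exact: muP.
  apply/funext => n; rewrite /p /= -mulrDl -fineD//; congr (fine _ / _).
  rewrite /S (esumID A)//; congr (_ + _)%E; congr esum.
    by apply/seteqP; split=> [y []//|y Ay]; split=> //; left.
  apply/seteqP; split=> [y [[Ay|//] /(_ Ay)//]|y By]; split; first by right.
  by move=> Ay; have : (A `&` B) y by []; rewrite AB0.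
- move=> g A; apply/eqP; rewrite eq_le mu_le/=.
  rewrite -{1}(_ : [set (g^-1 * y)%g | y in [set (g * y)%g | y in A]] = A) ?mu_le//.
  rewrite image_comp; under eq_imagel do rewrite /= mulKg.
  by rewrite image_id.
Qed.

End AlmostInvariant.

(** * Drift under an invariant mean *)

Section InvariantMean.
Variables (R : realType) (G : groupType) (mu : set G -> R).
Hypotheses (mu_ge0 : forall A, 0 <= mu A) (muT : mu setT = 1)
  (muU : forall A B, A `&` B = set0 -> mu (A `|` B) = mu A + mu B)
  (mu_inv : forall g A, mu [set (g * y)%g | y in A] = mu A).

(** The integral of [J \o c] against the finitely additive measure mu. Functions
    with finitely many values are enough below, and need no integration theory. *)
Definition mean (T : finType) (c : G -> T) (J : T -> R) : R :=
  \sum_t J t * mu (c @^-1` [set t]).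

Lemma mu_set0 : mu set0 = 0.
Proof. by apply: (addrI (mu set0)); rewrite addr0 -muU ?setI0// setU0. Qed.

Lemma mu_colouring (T : finType) (c : G -> T) (P : pred T) :
  mu [set y | P (c y)] = \sum_(t | P t) mu (c @^-1` [set t]).
Proof.
rewrite -big_filter; set r := [seq _ <- _ | _].
have {1}-> : [set y | P (c y)] = [set y | c y \in r].
  by apply/seteqP; split=> y; rewrite /r/= mem_filter mem_index_enum andbT.
have : uniq r by exact/filter_uniq/index_enum_uniq.
elim: r => [|t r IHr] /=.
  by move=> _; rewrite big_nil -mu_set0; congr mu; apply/seteqP; split.
case/andP=> tr ur; rewrite big_cons -IHr// -muU; last first.
  by apply/seteqP; split=> y//= -[->]; rewrite (negPf tr).
congr mu; apply/seteqP; split=> y /=; rewrite inE; first by case/predU1P; [left|right].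
by case=> [->|->]; rewrite ?eqxx ?orbT.
Qed.

Lemma mean_comp (T T' : finType) (c : G -> T) (p : T -> T') (J : T' -> R) :
  mean c (J \o p) = mean (p \o c) J.
Proof.
rewrite /mean (partition_big p xpredT)//=; apply: eq_bigr => t' _.
rewrite (_ : _ @^-1` _ = [set y | p (c y) == t']); last first.
  by apply/seteqP; split=> y /= /eqP.
rewrite (mu_colouring c (fun t => p t == t')) mulr_sumr.
by apply: eq_bigr => t /eqP ->.
Qed.

Lemma mean_shift (T : finType) (c : G -> T) (J : T -> R) (g : G) :
  mean (fun y => c (g * y)%g) J = mean c J.
Proof.
apply: eq_bigr => t _; congr (_ * _); rewrite -[LHS](mu_inv g); congr mu.
apply/seteqP; split=> [_ [y cy <-]//|y cy].
by exists (g^-1 * y)%g; rewrite /= mulVKg.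
Qed.

Lemma mean_le (T : finType) (c : G -> T) (J : T -> R) (k : R) :
  (forall y, J (c y) <= k) -> mean c J <= k.
Proof.
move=> Jk; rewrite -[leRHS]mulr1 -muT.
have -> : mu setT = \sum_t mu (c @^-1` [set t]).
  by rewrite -(mu_colouring c xpredT); congr mu; apply/seteqP; split.
rewrite mulr_sumr; apply: ler_sum => t _.
have [E|/set0P[y /= ty]] := eqVneq (c @^-1` [set t]) set0.
  by rewrite E mu_set0 !mulr0.
by rewrite -ty ler_wpM2r.
Qed.

Variables (V : finType) (s : V -> G) (inv : V -> V) (b : V -> R).
Hypotheses (invK : involutive inv) (s_inv : forall v, s (inv v) = (s v)^-1%g)
  (b_ge0 : forall v, 0 <= b v) (b_inv : forall v, b (inv v) = b v).

(** By invariance, the mean of F (s v * y) - F y is opposite to that of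
    F (s (inv v) * y) - F y, so the weighted means of the increments cancel. *)
Lemma no_negative_drift_int (F : G -> int) (B : nat) :
  (forall v y, `|F (s v * y)%g - F y| <= B%:Z) ->
  ~ forall y, \sum_v b v * (F (s v * y)%g - F y)%:~R <= -1 :> R.
Proof.
move=> FB drift; pose h v y := F (s v * y)%g - F y.
pose n := (B + B)%N.
(* The increment h v y lies in [-B, B]; it is shifted by B to index a finite
   type, on which opposite increments are exchanged by rev_ord. *)
pose c v y : 'I_n.+1 := inord `|(h v y + B%:Z)%R|%N.
pose value (i : 'I_n.+1) : R := (i%:Z - B%:Z)%:~R.
have cE v y : (c v y : nat)%:Z = h v y + B%:Z.
  have := FB v y; rewrite -/(h v y) ler_norml => /andP[h1 h2].
  rewrite /c inordK; lia.
have value_c v y : value (c v y) = (h v y)%:~R by rewrite /value cE addrK.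
have c_inv v y : c (inv v) (s v * y)%g = rev_ord (c v y).
  apply/val_inj/eqP; rewrite -eqz_nat /= -subzn ?ltn_ord// !intS !cE.
  by rewrite /h s_inv mulKg; lia.
have mean_inv v : mean (c (inv v)) value = - mean (c v) value.
  rewrite -(mean_shift _ _ (s v)) (_ : (fun _ => _) = @rev_ord _ \o c v).
    rewrite -mean_comp /mean -sumrN; apply: eq_bigr => i _.
    rewrite -mulNr; congr (_ * _); rewrite /= /value -mulrNz.
    by congr (_%:~R); rewrite /= -subzn ?ltn_ord//; lia.
  by apply/funext => y; rewrite c_inv.
have sum0 : \sum_v b v * mean (c v) value = 0.
  suff : \sum_v b v * mean (c v) value = - \sum_v b v * mean (c v) value.
    by move=> E; lra.
  rewrite [LHS](reindex_inj (inv_inj invK))/= -sumrN.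
  by apply: eq_bigr => v _; rewrite b_inv mean_inv mulrN.
(* All increments at y form a single colour, of which the drift is a function. *)
pose joint y : {ffun V -> 'I_n.+1} := [ffun v => c v y].
have : mean joint (fun t => \sum_v b v * value (t v)) <= -1.
  apply: mean_le => y; apply: le_trans (drift y).
  by apply: ler_sum => v _; rewrite ffunE value_c.
suff -> : mean joint (fun t => \sum_v b v * value (t v)) = 0 by lra.
rewrite -[RHS]sum0 [LHS]/mean; under [LHS]eq_bigr do rewrite mulr_suml.
rewrite exchange_big; apply: eq_bigr => v _ /=.
have -> : c v = (fun t : {ffun V -> 'I_n.+1} => t v) \o joint.
  by apply/funext => y; rewrite /= ffunE.
rewrite -mean_comp /mean mulr_sumr.
by apply: eq_bigr => t _; rewrite mulrA.
Qed.

(** Reduction to the integer-valued function floor (M * F), where M is large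
    enough for the rounding errors to be smaller than the drift. *)
Lemma no_negative_drift (F : G -> R) (K e : R) : 0 < e ->
  (forall v y, F (s v * y)%g - F y <= K) ->
  ~ forall y, \sum_v b v * (F (s v * y)%g - F y) <= - e.
Proof.
move=> e0 FK drift.
have FK' v y : `|F (s v * y)%g - F y| <= K.
  rewrite ler_norml FK andbT lerNl opprB.
  by have := FK (inv v) (s v * y)%g; rewrite s_inv mulKg.
pose M := (\sum_v b v + 1) / e.
have M0 : 0 < M by rewrite divr_gt0// ltr_wpDl// sumr_ge0.
pose Phi y : int := Num.floor (M * F y).
have Phi_le y : (Phi y)%:~R <= M * F y by exact: floor_le.
have Phi_gt y : M * F y < (Phi y)%:~R + 1.
  by have := floorD1_gt (M * F y); rewrite intrD.
pose B := Num.bound `|M * K + 1|.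
have MKB : M * K + 1 <= B%:R.
  exact: le_trans (ler_norm _) (ltW (archi_boundP (normr_ge0 _))).
apply: (@no_negative_drift_int Phi B) => [v y|y].
  rewrite -(ler_int R) intr_norm intrB /= -pmulrn.
  have := FK' v y; rewrite ler_norml => /andP[h1 h2].
  have := ler_wpM2l (ltW M0) h1; have := ler_wpM2l (ltW M0) h2.
  have := Phi_le y; have := Phi_gt y.
  have := Phi_le (s v * y)%g; have := Phi_gt (s v * y)%g.
  move=> *; rewrite ler_norml; apply/andP; split; lra.
have : M * \sum_v b v * (F (s v * y)%g - F y) <= M * - e by rewrite ler_pM2l.
rewrite mulrN {2}/M mulfVK ?gt_eqF// mulr_sumr => le1.
have : \sum_v b v * (Phi (s v * y)%g - Phi y)%:~R <=
    \sum_v (M * (b v * (F (s v * y)%g - F y)) + b v).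
  apply: ler_sum => v _; rewrite intrB.
  have le : (Phi (s v * y)%g)%:~R - (Phi y)%:~R <=
      M * (F (s v * y)%g - F y) + 1.
    have := Phi_le (s v * y)%g; have := Phi_gt y; lra.
  by apply: le_trans (ler_wpM2l (b_ge0 v) le) _; lra.
by rewrite big_split/=; lra.
Qed.

End InvariantMean.

(** * Convolution on a quotient of the free group *)

Section Spread.
Variables (R : realType) (d : nat) (x : letter d -> R).
Hypotheses (x_gt0 : forall v, 0 < x v) (x_lt1 : forall v, x v < 1)
  (x_sym : forall v, x (linv v) = x v).
Variables (G : groupType) (p : free_group d -> G).
Hypotheses (pM : forall g h, p (g * h)%g = (p g * p h)%g)
  (p_surj : forall y, exists g, p g = y).
Implicit Types (v w : letter d) (g h : free_group d) (f u : G -> R) (y : G).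

Let s v := p (gen v).
Let total_gt0 := total_rate_gt0 x_gt0 x_lt1.
Let jump_pos := jump_gt0 x_gt0 x_lt1.

Lemma hom1 : p 1%g = 1%g.
Proof. by apply: (mulgI (p 1%g)); rewrite -pM !mulg1. Qed.

Lemma homV g : p g^-1%g = (p g)^-1%g.
Proof. by apply: (mulgI (p g)); rewrite -pM !mulgV hom1. Qed.

Lemma hom_linv v : s (linv v) = (s v)^-1%g.
Proof. by rewrite /s gen_linv homV. Qed.

Lemma hom_gen_ind (P : G -> Prop) :
  P 1%g -> (forall v y, P y -> P (s v * y)%g) -> forall y, P y.
Proof.
move=> P1 PM y; have [g <-] := p_surj y.
elim/free_group_ind: g => [|v g IHg]; first by rewrite hom1.
by rewrite pM; exact: PM.
Qed.

(** Left convolution by the image of the weights in G. *)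
Definition spread f y : \bar R := mass x (fun g => f ((p g)^-1 * y)%g).

Lemma spread_ge0 f y : (forall y, 0 <= f y) -> (0 <= spread f y)%E.
Proof. by move=> f0; exact: mass_ge0. Qed.

(** With s v in place of its inverse: the rates are symmetric. *)
Lemma spread_green f y : (forall y, 0 <= f y) ->
  ((total_rate x)%:E * spread f y =
   (f y)%:E + \sum_v (jump x v)%:E * spread f (s v * y)%g)%E.
Proof.
move=> f0; rewrite /spread mass_green// hom1 invg1 mul1g; congr (_ + _)%E.
rewrite (reindex_inj (inv_inj (@linvK d)))/=; apply: eq_bigr => v _.
rewrite jump_linv//; congr (_ * mass _ _)%E; apply/funext => g.
by rewrite pM -/(s _) hom_linv invgM invgK mulgA.
Qed.

Lemma spread_gen_le f v y : (forall y, 0 <= f y) ->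
  ((jump x v)%:E * spread f (s v * y)%g <= (total_rate x)%:E * spread f y)%E.
Proof.
move=> f0; rewrite spread_green// (bigD1 v)//= addeCA.
apply: leeDl; apply: adde_ge0; first by rewrite lee_fin.
by apply: sume_ge0 => w _; rewrite mule_ge0 ?spread_ge0// lee_fin ltW.
Qed.

Lemma spread_delta_kernel :
  (\esum_(g in [set g | p g = 1%g]) (weight x g)%:E =
   spread (fun y => (y == 1%g)%:R) 1)%E.
Proof.
rewrite esum_mkcond; apply: eq_esum => g _.
rewrite mulg1 -[1%g in RHS]invg1 (inj_eq invg_inj).
have [pg|/eqP pg] := eqVneq (p g) 1%g; first by rewrite mulr1 mem_set.
by rewrite mulr0 memNset.
Qed.

(** The image of the weights in G is a positive supersolution, so its logarithm
    would have drift at most killing x at each point; an invariant mean excludes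
    a negative upper bound for the drift. *)
Lemma amenable_killing_ge0 : amenable R G ->
  (\esum_(g in [set g | p g = 1%g]) (weight x g)%:E < +oo)%E -> 0 <= killing x.
Proof.
move=> [mu [mu0 muT muU mu_inv]]; rewrite spread_delta_kernel.
set f : G -> R := fun y => _; move=> fin1.
rewrite leNgt; apply/negP => k0.
have f0 y : 0 <= f y by exact: ler0n.
(* Finiteness at 1 spreads to all of G: the Green identity at y bounds the value
   at each neighbour of y. Positivity spreads in the same way. *)
have fin y : spread f y \is a fin_num.
  rewrite ge0_fin_numE ?spread_ge0//.
  elim/hom_gen_ind: y => // v y fy.
  have : ((jump x v)%:E * spread f (s v * y)%g < +oo)%E.
    apply: le_lt_trans (spread_gen_le v y f0) _.
    by rewrite lte_mul_pinfty// lee_fin ltW.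
  rewrite ltNge leye_eq; apply: contraNT; rewrite -leNgt leye_eq => /eqP ->.
  by rewrite gt0_muley// lte_fin.
pose r y := fine (spread f y).
have rE y : spread f y = (r y)%:E by rewrite fineK.
have green y : total_rate x * r y = f y + \sum_v jump x v * r (s v * y)%g.
  apply: EFin_inj; rewrite EFinM -rE spread_green// EFinD -sumEFin.
  by congr (_ + _)%E; apply: eq_bigr => v _; rewrite EFinM rE.
have r_ge0 y : 0 <= r y by rewrite fine_ge0// spread_ge0.
have step v y : jump x v * r (s v * y)%g <= total_rate x * r y.
  by have := spread_gen_le v y f0; rewrite !rE.
have r_gt0 y : 0 < r y.
  elim/hom_gen_ind: y => [|v y ry].
    rewrite -(pmulr_rgt0 _ total_gt0) green /f eqxx ltr_pwDl// sumr_ge0// => v _.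
    by rewrite mulr_ge0// ltW.
  have := step (linv v) (s v * y)%g.
  rewrite hom_linv mulKg => /(lt_le_trans _) -/(_ 0).
  by rewrite pmulr_rgt0// pmulr_rgt0//; apply.
pose F y := ln (r y).
have F_le v y : F (s v * y)%g - F y <= r (s v * y)%g / r y - 1.
  have q0 : 0 < r (s v * y)%g / r y by rewrite divr_gt0.
  rewrite /F -ln_div ?posrE// -[in leLHS](subrK 1 (_ / _)) addrC.
  by rewrite le_ln1Dx// ltrBDl subrr.
apply: (@no_negative_drift R G mu mu0 muT muU mu_inv _ s (@linv d) (jump x)
  (@linvK d) hom_linv (fun v => ltW (jump_pos v)) (jump_linv x_sym) F
  (\sum_v total_rate x / jump x v) (- killing x)); first by rewrite oppr_gt0.
- move=> v y; apply: le_trans (F_le v y) _; rewrite lerBlDr.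
  apply: (@le_trans _ _ (total_rate x / jump x v)).
    by rewrite ler_pdivrMr// mulrAC ler_pdivlMr// mulrC step.
  rewrite (bigD1 v)//= -addrA lerDl addr_ge0// sumr_ge0// => w _.
  by rewrite divr_ge0 ?ltW.
- move=> y; rewrite opprK.
  apply: (@le_trans _ _ (\sum_v jump x v * (r (s v * y)%g / r y - 1))).
    by apply: ler_sum => v _; rewrite ler_wpM2l// ltW.
  under eq_bigr do rewrite mulrBr mulr1 mulrA.
  rewrite sumrB -mulr_suml lerBlDr -/(total_rate x) ler_pdivrMr//.
  by rewrite green lerDr.
Qed.

Lemma spread_l1 f : (forall y, 0 <= f y) -> (mass x (fun=> 1%R) < +oo)%E ->
  (\esum_(y in [set: G]) (f y)%:E < +oo)%E ->
  (\esum_(y in [set: G]) spread f y < +oo)%E.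
Proof.
move=> f0 fin1 finf; have w0 := weight_ge0 x_gt0.
have f_ge0 : (0 <= \esum_(y in [set: G]) (f y)%:E)%E.
  by apply: esum_ge0 => y _; rewrite lee_fin.
have S0 := fine_ge0 f_ge0; move: S0.
set S := fine _ => S0; have SE : \esum_(y in [set: G]) (f y)%:E = S%:E.
  by rewrite fineK// ge0_fin_numE.
rewrite /spread /mass esum_exchange; last first.
  by move=> y g; rewrite lee_fin mulr_ge0.
rewrite (_ : (fun _ => _) = (fun g => S%:E * (weight x g * 1)%:E)%E).
  by rewrite esumZl ?lte_mul_pinfty// => g; rewrite lee_fin mulr1.
apply/funext => g; rewrite mulr1 muleC -SE.
rewrite -(esum_mulg (p g)^-1%g (fun y => (f y)%:E)) -esumZl//.
by move=> y; rewrite lee_fin.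
Qed.

Lemma spread_fin f y : (forall y, 0 <= f y) -> (mass x (fun=> 1%R) < +oo)%E ->
  (\esum_(y in [set: G]) (f y)%:E < +oo)%E -> spread f y \is a fin_num.
Proof.
move=> f0 fin1 finf; have Rf0 z : (0 <= spread f z)%E := spread_ge0 z f0.
rewrite ge0_fin_numE//; apply: le_lt_trans (spread_l1 f0 fin1 finf).
exact: (@esum_ge_term _ _ (spread f)).
Qed.

(** If u is the convolution of f, then testing the equation L u = f on u gives
    kap / 2 * dirichlet u <= <f, u>, and the gap turns the left-hand side into a
    multiple of the energy of u. The bound depends on the weights only through
    the lower bound kap of the rates. *)
Lemma energy_spread (kap e : R) f : 0 < kap -> (forall v, kap <= jump x v) ->
  0 < e -> (forall u, (energy u < +oo)%E -> (e%:E * energy u <= dirichlet s u)%E) ->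
  (mass x (fun=> 1%R) < +oo)%E ->
  (forall y, 0 <= f y) -> (\esum_(y in [set: G]) (f y)%:E < +oo)%E ->
  (((kap * e / 2) ^+ 2)%:E * energy (fun y => fine (spread f y)) <= energy f)%E.
Proof.
move=> kap0 kap_le e0 gap fin1 f0 finf.
set u := (fun y => _); set a := kap * e / 2.
have a0 : 0 < a by rewrite /a !mulr_gt0.
have k0 : 0 < killing x by apply/(mass1_lty x_gt0 x_lt1 x_sym).
have Ru y : spread f y = (u y)%:E by rewrite fineK// spread_fin.
have u0 y : 0 <= u y by rewrite fine_ge0// spread_ge0.
have green y : total_rate x * u y = f y + \sum_v jump x v * u (s v * y)%g.
  apply: EFin_inj; rewrite EFinM -Ru spread_green// EFinD -sumEFin.
  by congr (_ + _)%E; apply: eq_bigr => v _; rewrite EFinM Ru.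
have fin_u : (energy u < +oo)%E.
  apply: energy_lty => //; rewrite (_ : esum _ _ = \esum_(y in [set: G]) spread f y).
    exact: spread_l1.
  by apply: eq_esum => y _; rewrite Ru.
have fin_f : (energy f < +oo)%E by exact: energy_lty.
pose J := \sum_v jump x v.
have J0 : 0 <= J by apply: sumr_ge0 => v _; rewrite ltW.
(* The equation times u y, with u y * u (s v * y) expanded as half the squares of
   both minus half the square of their difference. *)
have pointwise y :
    kap / 2 * \sum_v (u (s v * y)%g - u y) ^+ 2 + J / 2 * u y ^+ 2 <=
    (a / 2 * u y ^+ 2 + a^-1 / 2 * f y ^+ 2) +
    \sum_v jump x v / 2 * u (s v * y)%g ^+ 2.
  have le1 : kap / 2 * \sum_v (u (s v * y)%g - u y) ^+ 2 <=
      \sum_v jump x v / 2 * (u (s v * y)%g - u y) ^+ 2.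
    rewrite mulr_sumr; apply: ler_sum => v _.
    by rewrite ler_wpM2r ?sqr_ge0// ler_pM2r.
  have E2 : \sum_v jump x v / 2 * (u (s v * y)%g - u y) ^+ 2 =
      \sum_v jump x v / 2 * u (s v * y)%g ^+ 2 -
      u y * (\sum_v jump x v * u (s v * y)%g) + J / 2 * u y ^+ 2.
    rewrite mulr_sumr /J !mulr_suml -sumrB -big_split/=.
    by apply: eq_bigr => v _; field.
  have E3 : \sum_v jump x v * u (s v * y)%g = total_rate x * u y - f y.
    by rewrite green addrC addKr.
  have young : f y * u y <= a / 2 * u y ^+ 2 + a^-1 / 2 * f y ^+ 2.
    rewrite -subr_ge0 (_ : _ - _ = a^-1 / 2 * (a * u y - f y) ^+ 2).
      by rewrite mulr_ge0 ?sqr_ge0// divr_ge0// invr_ge0 ltW.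
    by field; exact: lt0r_neq0.
  have ku : 0 <= killing x * u y ^+ 2 by rewrite mulr_ge0 ?sqr_ge0// ltW.
  move: le1; rewrite E2 E3 /total_rate -/J; lra.
have sq (h : G -> R) y : (0%:E <= (h y ^+ 2)%:E)%E by rewrite lee_fin sqr_ge0.
have sqB v y : (0%:E <= ((u (s v * y)%g - u y) ^+ 2)%:E)%E by rewrite lee_fin sqr_ge0.
have h0 : 0 <= kap / 2 by rewrite divr_ge0 ?ltW.
have h1 : 0 <= J / 2 by rewrite divr_ge0.
have h2 : 0 <= a / 2 by rewrite divr_ge0 ?ltW.
have h3 : 0 <= a^-1 / 2 by rewrite divr_ge0 ?invr_ge0 ?ltW.
have h4 v : 0 <= jump x v / 2 by rewrite divr_ge0// ltW.
have : ((kap / 2)%:E * dirichlet s u + (J / 2)%:E * energy u <=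
        ((a / 2)%:E * energy u + (a^-1 / 2)%:E * energy f) +
        (J / 2)%:E * energy u)%E.
  have -> : ((kap / 2)%:E * dirichlet s u + (J / 2)%:E * energy u =
    \esum_(y in [set: G]) (kap / 2 * \sum_v (u (s v * y)%g - u y) ^+ 2 +
       J / 2 * u y ^+ 2)%:E)%E.
    rewrite /dirichlet -esum_sum; last by move=> y v _ _; exact: sqB.
    rewrite /energy -!esumZl//; last by move=> y; apply: sume_ge0 => v _; exact: sqB.
    rewrite -esumD//; last first.
    - by move=> y _; apply: mule_ge0; rewrite lee_fin ?sqr_ge0.
    - by move=> y _; apply: mule_ge0; [rewrite lee_fin|apply: sume_ge0 => v _; exact: sqB].
    by apply: eq_esum => y _; rewrite sumEFin -!EFinM -EFinD.
  have -> : (((a / 2)%:E * energy u + (a^-1 / 2)%:E * energy f) +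
        (J / 2)%:E * energy u =
    \esum_(y in [set: G]) ((a / 2 * u y ^+ 2 + a^-1 / 2 * f y ^+ 2) +
    \sum_v jump x v / 2 * u (s v * y)%g ^+ 2)%:E)%E.
    have -> : ((J / 2)%:E * energy u = \esum_(y in [set: G]) \sum_v
        (jump x v / 2)%:E * (u (s v * y)%g ^+ 2)%:E)%E.
      rewrite esum_sum; last by move=> y v _ _; rewrite mule_ge0// lee_fin.
      under eq_bigr => v _.
        rewrite esumZl// (esum_mulg (s v) (fun y => (u y ^+ 2)%:E)) -/(energy u).
        over.
      rewrite -ge0_sume_distrl; last by move=> v _; rewrite lee_fin.
      by rewrite /J mulr_suml -sumEFin.
    rewrite /energy -!esumZl// -!esumD//; last first.
    - by move=> y _; apply: mule_ge0; rewrite lee_fin ?sqr_ge0.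
    - by move=> y _; apply: mule_ge0; rewrite lee_fin ?sqr_ge0.
    - move=> y _; apply: sume_ge0 => v _.
      by apply: mule_ge0; rewrite lee_fin ?sqr_ge0.
    - by move=> y _; apply: adde_ge0; apply: mule_ge0; rewrite lee_fin ?sqr_ge0.
    apply: eq_esum => y _; under eq_bigr do rewrite -EFinM.
    by rewrite sumEFin -!EFinM -!EFinD.
  by apply: le_esum => y _; rewrite lee_fin.
have := gap u fin_u.
have fe (h : G -> R) : (energy h < +oo)%E -> energy h = (fine (energy h))%:E.
  by move=> hf; rewrite fineK// ge0_fin_numE// energy_ge0.
have [Ef0 Eu0] := (fine_ge0 (energy_ge0 f), fine_ge0 (energy_ge0 u)).
rewrite (fe _ fin_u) (fe _ fin_f) -!EFinM -!EFinD.
set Eu := fine (energy u) in Eu0 *; set Ef := fine (energy f) in Ef0 *.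
have [->|Dfin] := eqVneq (dirichlet s u) +oo%E.
  by rewrite gt0_muley ?lte_fin ?divr_gt0// addye// leye_eq.
have Dn : dirichlet s u \is a fin_num.
  by rewrite ge0_fin_numE ?dirichlet_ge0// ltey.
rewrite -(fineK Dn) -EFinM -EFinD !lee_fin.
set D := fine _; move=> eD le1.
have {}le1 : a / 2 * Eu <= a^-1 / 2 * Ef.
  have : kap / 2 * (e * Eu) <= kap / 2 * D by rewrite ler_wpM2l.
  rewrite /a in le1 *; lra.
have := ler_wpM2l (ltW (mulr_gt0 (ltr0n R 2 : 0 < 2) a0)) le1.
rewrite (_ : 2 * a * (a^-1 / 2 * Ef) = Ef); last by field; exact: lt0r_neq0.
by rewrite (_ : 2 * a * (a / 2 * Eu) = a ^+ 2 * Eu)//; field.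
Qed.

(** * Growth of the kernel under a spectral gap *)

Definition fg_take i g : free_group d :=
  FreeGroup (take_sorted i (fg_reduced g) : reduced (take i g)).
Definition fg_drop i g : free_group d :=
  FreeGroup (drop_sorted i (fg_reduced g) : reduced (drop i g)).

Lemma fg_take_mul_drop i g : (fg_take i g * fg_drop i g)%g = g.
Proof.
apply: val_inj => /=; have := fg_reduced g.
rewrite -{1 4}(cat_take_drop i (fg_word g)).
elim: (take i g) => [//|v t IHt] /= rt.
by rewrite IHt ?lcons_cons//; exact: path_sorted rt.
Qed.

Lemma sum_le_mass (phi : free_group d -> R) (r : seq (free_group d)) :
  (forall g, 0 <= phi g) -> uniq r ->
  ((\sum_(g <- r) weight x g * phi g)%:E <= mass x phi)%E.
Proof.
move=> phi0 ur; apply: esum_ge; exists [set` r]; first by split=> //; exact: finite_seq.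
by rewrite -sumEFin (fsbig_seq _ _ ur).
Qed.

(** Distinct prefixes of g are distinct group elements. *)
Lemma prefix_sum_le_mass (phi : free_group d -> R) g : (forall g, 0 <= phi g) ->
  ((\sum_(i < (size (fg_word g)).+1) weight x (fg_take i g) * phi (fg_take i g))%:E
   <= mass x phi)%E.
Proof.
move=> phi0; pose r := [seq fg_take i g | i <- iota 0 (size (fg_word g)).+1].
have ur : uniq r.
  rewrite map_inj_in_uniq ?iota_uniq// => i j; rewrite !mem_iota !ltnS /= => im jm.
  by move=> /(congr1 (fun h => size (fg_word h))) /=; rewrite !size_takel.
apply: le_trans (sum_le_mass phi0 ur); rewrite big_map.
by rewrite -(big_mkord xpredT (fun i => weight x (fg_take i g) * phi (fg_take i g)))
  /index_iota subn0.
Qed.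

Section Growth.
Variables (z : R) (n : nat).
Hypothesis z0 : 0 <= z.

(** The cut-off at length n makes the sums finite before they are known to
    converge. It is compatible with passing to suffixes. *)
Definition boosted g : R :=
  (size (fg_word g) <= n)%N%:R * ((1 + z) ^+ size (fg_word g) * weight x g).

Lemma boosted_ge0 g : 0 <= boosted g.
Proof.
by rewrite !mulr_ge0 ?ler0n ?exprn_ge0 ?weight_ge0// addr_ge0.
Qed.

Let source g : R := (g == 1%g)%:R + z * boosted g.

Lemma source_ge0 g : 0 <= source g.
Proof. by rewrite addr_ge0 ?ler0n// mulr_ge0 ?boosted_ge0. Qed.

(** Splitting g into a prefix h and a suffix in all possible ways turns the
    claim into (1 + z)^m <= 1 + z * (sum over i <= m of (1 + z)^i), a
    geometric sum. *)
Lemma boosted_le g : ((boosted g)%:E <= mass x (fun h => source (h^-1 * g)%g))%E.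
Proof.
have [gn|gn] := leqP (size (fg_word g)) n; last first.
  rewrite /boosted leqNgt gn mul0r; apply: mass_ge0 => // h.
  exact: source_ge0.
apply: le_trans (prefix_sum_le_mass g (fun h => source_ge0 _)).
rewrite lee_fin /boosted gn mul1r; set m := size _.
have term (i : 'I_m.+1) : weight x (fg_take i g) * source ((fg_take i g)^-1 * g)%g
    = weight x g * ((i == ord_max)%:R + z * (1 + z) ^+ (m - i)).
  rewrite -[X in (_ * X)%g](fg_take_mul_drop i g) mulKg.
  rewrite /source /boosted /= size_drop.
  rewrite (leq_trans (leq_subr _ _) gn) mul1r -/m.
  have -> : weight x g = weight x (take i g) * weight x (drop i g).
    by rewrite -[in LHS](cat_take_drop i g) /weight big_cat.
  rewrite -val_eqE /= -size_eq0 size_drop -/m subn_eq0.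
  have -> : (m <= i)%N = (i == ord_max).
    by rewrite -val_eqE /= eqn_leq leq_ord.
  have [->|_] := eqVneq i ord_max; last by rewrite !add0r; ring.
  by rewrite drop_oversize// /weight big_nil; ring.
rewrite (eq_bigr _ (fun i _ => term i)) -mulr_sumr mulrC.
rewrite ler_wpM2l ?weight_ge0// big_split/= (bigD1 ord_max)//= eqxx.
rewrite big1 => [|i /negPf ->//]; rewrite addr0 -mulr_sumr.
have := subrXX (1 + z) 1 m.+1; rewrite expr1n [1 + z]addrC addrK.
under eq_bigr do rewrite expr1n mulr1 /=.
move=> <-; rewrite mulr1n [1 + _]addrC subrK exprS ler_peMl ?lerDr// exprn_ge0//.
by rewrite addr_ge0.
Qed.

End Growth.

Definition push (phi : free_group d -> R) y : \bar R :=
  \esum_(g in [set: free_group d]) ((y == p g)%:R * phi g)%:E.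

Lemma push_ge0 phi y : (forall g, 0 <= phi g) -> (0 <= push phi y)%E.
Proof. by move=> phi0; apply: esum_ge0 => g _; rewrite lee_fin mulr_ge0. Qed.

Lemma push_l1 phi : (forall g, 0 <= phi g) ->
  (\esum_(y in [set: G]) push phi y =
   \esum_(g in [set: free_group d]) (phi g)%:E)%E.
Proof.
move=> phi0; rewrite /push esum_exchange => [|y g]; last first.
  by rewrite lee_fin mulr_ge0.
by apply: eq_esum => g _; rewrite (@esum_delta _ _ (p g) (fun=> phi g)).
Qed.

(** Convolution commutes with the projection onto G. *)
Lemma push_spread phi f y : (forall g, 0 <= phi g) ->
  (forall y, push phi y = (f y)%:E) ->
  (\esum_(g in [set: free_group d])
     ((y == p g)%:R%:E * mass x (fun h => phi (h^-1 * g)%g)) = spread f y)%E.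
Proof.
move=> phi0 pf; have w0 := weight_ge0 x_gt0.
have t0 (b : bool) g h : (0 <= b%:R%:E * (weight x h * phi g)%:E)%E.
  by rewrite -EFinM lee_fin !mulr_ge0.
under eq_esum => g _.
  rewrite -esumZl ?ler0n//; last by move=> h; rewrite lee_fin mulr_ge0.
  over.
rewrite esum_exchange//; apply: eq_esum => h _.
rewrite -(esum_mulg h) EFinM -pf -esumZl//; last first.
  by move=> g; rewrite lee_fin mulr_ge0.
apply: eq_esum => g _; rewrite mulKg -!EFinM pM.
rewrite (can2_eq (mulVKg (p h)) (mulKg (p h))).
by rewrite mulrCA.
Qed.

(** With z = a / 2, where 1 / a bounds the convolution in l^2, the push-forward w
    of the boosted weights satisfies
      a^2 |w|^2 <= |delta + z w|^2 <= 2 + 2 z^2 |w|^2 = 2 + a^2 |w|^2 / 2,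
    whence w 1 <= |w| <= 2 / a uniformly in the cut-off. *)
Lemma kernel_growth (kap e : R) : 0 < kap -> (forall v, kap <= jump x v) ->
  0 < e -> (forall u, (energy u < +oo)%E -> (e%:E * energy u <= dirichlet s u)%E) ->
  (mass x (fun=> 1%R) < +oo)%E ->
  (\esum_(g in [set g | p g = 1%g])
     ((1 + kap * e / 4) ^+ size (fg_word g) * weight x g)%:E < +oo)%E.
Proof.
move=> kap0 kap_le e0 gap fin1.
pose a := kap * e / 2; pose z := a / 2.
have zE : kap * e / 4 = z by rewrite /z /a; field.
have a0 : 0 < a by rewrite /a !mulr_gt0.
have z0 : 0 < z by rewrite divr_gt0.
have zge0 := ltW z0; rewrite zE.
apply: (@le_lt_trans _ _ (2 / a)%:E); last exact: ltry.
apply: ge_ereal_sup => _ [X [finX XN] <-].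
pose n := (\max_(g <- (fset_set X : seq (free_group d))) size (fg_word g))%N.
pose W := boosted z n; have W0 : forall g, 0 <= W g by exact: boosted_ge0.
have finW : (\esum_(g in [set: free_group d]) (W g)%:E < +oo)%E.
  apply: (@le_lt_trans _ _ (((1 + z) ^+ n)%:E * mass x (fun=> 1%R))%E).
    rewrite /mass -esumZl ?exprn_ge0 ?addr_ge0//; last first.
      by move=> g; rewrite lee_fin mulr1 weight_ge0.
    apply: le_esum => g _; rewrite mulr1 -EFinM lee_fin /W /boosted.
    case: leqP => gn; last by rewrite mul0r mulr_ge0 ?exprn_ge0 ?addr_ge0 ?weight_ge0.
    by rewrite mul1r ler_wpM2r ?weight_ge0// ler_weXn2l// lerDl.
  by rewrite lte_mul_pinfty// lee_fin exprn_ge0 ?addr_ge0.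
have push_fin y : push W y \is a fin_num.
  rewrite ge0_fin_numE ?push_ge0//; apply: le_lt_trans finW.
  rewrite -push_l1//; apply: (@esum_ge_term _ _ (push W)) => y'.
  exact: push_ge0.
pose w y := fine (push W y).
have wE y : push W y = (w y)%:E by rewrite fineK.
have w0 y : 0 <= w y by rewrite fine_ge0// push_ge0.
have fin_w : (\esum_(y in [set: G]) (w y)%:E < +oo)%E.
  by rewrite (eq_esum (fun y _ => esym (wE y))) push_l1.
pose delta y : R := (y == 1%g)%:R.
have sum_delta (T : choiceType) (t : T) :
    (\esum_(y in [set: T]) ((y == t)%:R : R)%:E = 1)%E.
  rewrite -[RHS](@esum_delta R T t (fun=> 1%R))//.
  by apply: eq_esum => y _; rewrite mulr1.
pose f y := delta y + z * w y.
have f0 y : 0 <= f y by rewrite addr_ge0 ?ler0n// mulr_ge0.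
have fin_f : (\esum_(y in [set: G]) (f y)%:E < +oo)%E.
  under eq_esum do rewrite EFinD EFinM.
  rewrite esumD => [||y _]; last 2 first.
  - by move=> y _; rewrite lee_fin ler0n.
  - by rewrite -EFinM lee_fin mulr_ge0.
  rewrite sum_delta esumZl//.
  by rewrite lte_add_pinfty ?ltry// lte_mul_pinfty.
pose src g : R := (g == 1%g)%:R + z * W g.
have src0 g : 0 <= src g by exact: source_ge0.
have pushE y : push src y = (f y)%:E.
  rewrite /push; under eq_esum do rewrite mulrDr EFinD mulrCA [_ * (_ == _)%:R]mulrC.
  rewrite esumD => [||g _]; last 2 first.
  - by move=> g _; rewrite lee_fin mulr_ge0.
  - by rewrite lee_fin mulr_ge0// mulr_ge0.
  rewrite (@esum_delta _ _ 1%g (fun g => (y == p g)%:R))// hom1 EFinD; congr (_ + _)%E.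
  rewrite EFinM -wE /push -esumZl//; last by move=> g; rewrite lee_fin mulr_ge0.
have w_le y : w y <= fine (spread f y).
  rewrite -lee_fin -wE fineK ?spread_fin// -(push_spread y src0 pushE).
  apply: le_esum => g _; rewrite EFinM lee_wpmul2l ?lee_fin//.
  exact: boosted_le.
have Efin (h : G -> R) : (forall y, 0 <= h y) ->
    (\esum_(y in [set: G]) (h y)%:E < +oo)%E -> energy h \is a fin_num.
  by move=> h0 hf; rewrite ge0_fin_numE ?energy_ge0// energy_lty.
have sq (h : G -> R) y : (0%:E <= (h y ^+ 2)%:E)%E by rewrite lee_fin sqr_ge0.
have le1 : ((a ^+ 2)%:E * energy w <= 2%:E + (a ^+ 2 / 2)%:E * energy w)%E.
  apply: (@le_trans _ _ (energy f)).
    apply: le_trans (energy_spread kap0 kap_le e0 gap fin1 f0 fin_f).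
    rewrite lee_wpmul2l ?lee_fin ?sqr_ge0//; apply: le_esum => y _.
    by rewrite lee_fin lerXn2r ?nnegrE// ?fine_ge0 ?spread_ge0.
  have -> : (2%:E + (a ^+ 2 / 2)%:E * energy w = \esum_(y in [set: G])
      (2 * delta y + a ^+ 2 / 2 * w y ^+ 2)%:E)%E.
    under [RHS]eq_esum do rewrite EFinD EFinM [(_ / _ * _)%:E]EFinM.
    have a2 : 0 <= a ^+ 2 / 2 by rewrite divr_ge0 ?sqr_ge0.
    rewrite esumD; last 2 first.
    - by move=> y _; rewrite -EFinM lee_fin mulr_ge0.
    - by move=> y _; apply: mule_ge0; rewrite lee_fin ?sqr_ge0.
    by rewrite /delta !esumZl// sum_delta mule1.
  apply: le_esum => y _; rewrite lee_fin -subr_ge0 /f /delta.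
  case: (y == 1%g) => /=.
    rewrite (_ : _ - _ = (1 - z * w y) ^+ 2) ?sqr_ge0//.
    by rewrite /z; field.
  rewrite (_ : _ - _ = (z * w y) ^+ 2) ?sqr_ge0//.
  by rewrite /z; field.
have EwE : energy w = (fine (energy w))%:E by rewrite fineK// Efin.
have w1E : w 1%g ^+ 2 <= fine (energy w).
  by rewrite -lee_fin -EwE; apply: (@esum_ge_term _ _ (fun y => (w y ^+ 2)%:E)).
move: le1; rewrite EwE -!EFinM -EFinD lee_fin => le1.
have w1_le : w 1%g <= 2 / a.
  rewrite ler_pdivlMr// -(@ler_pXn2r _ 2) ?nnegrE ?(mulr_ge0 (w0 _) (ltW a0))//.
  rewrite exprMn -[_ ^+ 2 * _]mulrC.
  have := ler_wpM2l (sqr_ge0 a) w1E; move: le1; lra.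
rewrite fsbig_finite//= sumEFin.
apply: (@le_trans _ _ (push W 1%g)); last by rewrite wE lee_fin.
apply: esum_ge; exists X => //.
rewrite fsbig_finite//= sumEFin lee_fin big_seq [leRHS]big_seq.
apply: ler_sum => g gX; have := gX; rewrite in_fset_set// => /set_mem/XN /= ->.
rewrite eqxx mul1r /W /boosted (_ : (size _ <= n)%N) ?mul1r//.
exact: (leq_bigmax_seq g gX).
Qed.

End Spread.

(** * Exponents of convergence *)

Section Powers.
Variable R : realType.
Implicit Types c t y : R.

Lemma powR_onto c y : 0 < c < 1 -> 0 < y < 1 -> exists2 t, 0 < t & c `^ t = y.
Proof.
move=> /andP[c0 c1] /andP[y0 y1].
have lc : ln c < 0 by rewrite ln_lt0// c0.
have ly : ln y < 0 by rewrite ln_lt0// y0.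
exists (ln y / ln c); first by rewrite nmulr_rgt0// invr_lt0.
by rewrite /powR gt_eqF// mulfVK ?lt_eqF// lnK.
Qed.

Lemma ltr_powR_lt1 c t t' : 0 < c < 1 -> t < t' -> c `^ t' < c `^ t.
Proof.
move=> /andP[c0 c1] tt'; have lc : ln c < 0 by rewrite ln_lt0// c0.
by rewrite /powR gt_eqF// ltr_expR ltr_nM2r.
Qed.

End Powers.

Section Kernel.
Variables (G : groupType) (N : normal_subgroup G).

Lemma quotient_proj_eq1 (g : G) : (quotient_proj N g = 1%g) <-> ns_set N g.
Proof.
have <- : quotient_proj N 1%g = 1%g by [].
split=> [/esym/(eqmodP (coset_equiv N))/asboolP|Ng].
  by rewrite invg1 mul1g.
by symmetry; apply: eq_proj; rewrite invg1 mul1g.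
Qed.

End Kernel.

Section Exponents.
Variables (R : realType) (d : nat) (Phi : linear_gdms R d).
Hypotheses (hd : (2 <= d)%N) (hPhi : symmetric_gdms Phi).
Implicit Types (v : letter d) (g : free_group d) (t : R).

Let c := gdms_ratio Phi.
Let c_in01 v : 0 < c v < 1.
Proof. by rewrite gdms_ratio_gt0 gdms_ratio_lt1. Qed.

Definition ratio_pow t v : R := c v `^ t.

Lemma ratio_pow_gt0 t v : 0 < ratio_pow t v.
Proof. by rewrite powR_gt0; case/andP: (c_in01 v). Qed.

Lemma ratio_pow_lt1 t v : 0 < t -> ratio_pow t v < 1.
Proof. by move=> t0; rewrite -(powRr0 (c v)) ltr_powR_lt1. Qed.

Lemma ratio_pow_sym t v : ratio_pow t (linv v) = ratio_pow t v.
Proof. by rewrite /ratio_pow /c -hPhi. Qed.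

Lemma word_ratio_gt0 g : 0 < word_ratio Phi g.
Proof. by apply: prodr_gt0 => v _; case/andP: (c_in01 v). Qed.

Lemma word_ratio_pow g t : word_ratio Phi g `^ t = weight (ratio_pow t) g.
Proof.
rewrite /word_ratio /weight; elim: (fg_word g) => [|v s IHs].
  by rewrite !big_nil powR1.
rewrite !big_cons powRM ?IHs//; first by rewrite ltW; case/andP: (c_in01 v).
by apply: prodr_ge0 => w _; rewrite ltW; case/andP: (c_in01 w).
Qed.

Definition poincare (H : set (free_group d)) t : \bar R :=
  \esum_(h in H) (word_ratio Phi h `^ t)%:E.

Lemma poincare_le H t t' : t <= t' -> (poincare H t' <= poincare H t)%E.
Proof.
move=> tt'; apply: le_esum => g _; rewrite lee_fin ger_powR//.
rewrite word_ratio_gt0/= /word_ratio; elim: (fg_word g) => [|v s IHs].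
  by rewrite big_nil.
have /andP[v0 v1] := c_in01 v.
rewrite big_cons mulr_ile1 ?(ltW v0) ?(ltW v1)//.
by apply: prodr_ge0 => w _; case/andP: (c_in01 w) => /ltW.
Qed.

Lemma poincareT t : poincare setT t = mass (ratio_pow t) (fun=> 1%R).
Proof. by apply: eq_esum => g _; rewrite word_ratio_pow mulr1. Qed.

Lemma poincareT_lty t : 0 < t ->
  (poincare setT t < +oo)%E <-> 0 < killing (ratio_pow t).
Proof.
move=> t0; rewrite poincareT; apply: mass1_lty.
- exact: ratio_pow_gt0.
- by move=> v; exact: ratio_pow_lt1.
- exact: ratio_pow_sym.
Qed.

Lemma killing_lt t t' : t < t' ->
  killing (ratio_pow t) < killing (ratio_pow t').
Proof.
move=> tt'; rewrite /killing ltrD2l ltrN2; apply: ltr_sum => [|v _].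
  apply/hasP; exists (Ordinal (ltnW hd), true) => //; exact: mem_index_enum.
have := ltr_powR_lt1 (c_in01 v) tt'; rewrite -/(ratio_pow t v) -/(ratio_pow t' v).
have := ratio_pow_gt0 t v; have := ratio_pow_gt0 t' v => x0 y0 xy.
by rewrite ltr_pdivrMr ?addr_gt0// mulrAC ltr_pdivlMr ?addr_gt0//; lra.
Qed.

Lemma exponent_le H t : 0 <= t -> (poincare H t < +oo)%E ->
  (exponent_of_convergence Phi H <= t%:E)%E.
Proof. by move=> t0 fin; apply: ereal_inf_lbound; exists t. Qed.

Lemma exponent_lt_poincare H t : (exponent_of_convergence Phi H < t%:E)%E ->
  (poincare H t < +oo)%E.
Proof.
move=> /ereal_inf_lt[_ [t' [t'0 fin] <-]]; rewrite lte_fin => /ltW t't.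
exact: le_lt_trans (poincare_le H t't) fin.
Qed.

Lemma exponent_subset (H H' : set (free_group d)) : H `<=` H' ->
  (exponent_of_convergence Phi H <= exponent_of_convergence Phi H')%E.
Proof.
move=> HH'; apply: le_ereal_inf_tmp => _ [t [t0 fin] <-].
apply: exponent_le => //; apply: le_lt_trans fin.
rewrite /poincare esum_mkcond [leRHS]esum_mkcond; apply: le_esum => g _.
case: ifPn => [/set_mem/HH' H'g|_]; first by rewrite mem_set.
by case: ifP => // _; rewrite lee_fin powR_ge0.
Qed.

Let cmin : R := \prod_v c v.

Let cmin_le v : cmin <= c v.
Proof.
rewrite /cmin (bigD1 v)//= ler_piMr//; first by case/andP: (c_in01 v) => /ltW.
by apply: prodr_ile1 => w _; case/andP: (c_in01 w) => /ltW -> /ltW.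
Qed.

Let cmin_in01 : 0 < cmin < 1.
Proof.
rewrite prodr_gt0 => [|v _]; last by case/andP: (c_in01 v).
pose v0 : letter d := (Ordinal (ltnW hd), true).
by apply: le_lt_trans (cmin_le v0) _; case/andP: (c_in01 v0).
Qed.

(** Positivity uses d >= 2: the killing rate tends to 1 - d as t tends to 0. *)
Lemma exponentT_fin_pos : exists2 delta : R, 0 < delta &
  exponent_of_convergence Phi setT = delta%:E.
Proof.
have card_letter : #|{: letter d}| = (d * 2)%N by rewrite card_prod card_ord card_bool.
have [t0 t0_gt0 t0E] := @powR_onto R cmin 2^-1 cmin_in01 ltac:(apply/andP; split; lra).
(* The weights x are at least 1 / 2 at t0, so x / (1 + x) is at least 1 / 3, and
   there are at least four letters: the killing rate is negative. *)
have low : (t0%:E <= exponent_of_convergence Phi setT)%E.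
  rewrite leNgt; apply/negP => /exponent_lt_poincare /(poincareT_lty t0_gt0).
  apply/negP; rewrite -leNgt /killing subr_le0.
  apply: (@le_trans _ _ (\sum_(v : letter d) 3^-1)).
    rewrite sumr_const card_letter -mulr_natr.
    have : (4 <= d * 2)%N by rewrite (leq_mul hd (leqnn 2)).
    rewrite -(ler_nat R) => h4; lra.
  apply: ler_sum => v _.
  have : 2^-1 <= ratio_pow t0 v.
    rewrite -t0E; apply: ge0_ler_powR; rewrite ?nnegrE ?(ltW t0_gt0)//.
    - by rewrite ltW; case/andP: cmin_in01.
    - by rewrite ltW; case/andP: (c_in01 v).
  by move=> h; rewrite ler_pdivlMr; lra.
have [t1 t1_gt0 t1_fin] : exists2 t, 0 < t & (poincare setT t < +oo)%E.
  (* Each of the 2 d weights is at most 1 / (2 d + 1) at the sum of the T v, so that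
     their sum is less than 1. *)
  pose y : R := ((d * 2)%:R + 1)^-1.
  have y01 : 0 < y < 1.
    rewrite invr_gt0 invf_lt1 ltr_pwDr ?ler0n//=.
    by rewrite ltrDr ltr0n muln_gt0 (ltn_trans _ hd).
  have /choice[T TP] : forall v, exists t, 0 < t /\ c v `^ t = y.
    by move=> v; have [t ? ?] := powR_onto (c_in01 v) y01; exists t.
  have T0 : 0 <= \sum_v T v by apply: sumr_ge0 => v _; case: (TP v) => /ltW.
  exists (1 + \sum_v T v); first by rewrite ltr_pwDl.
  apply/poincareT_lty; first by rewrite ltr_pwDl.
  rewrite /killing subr_gt0.
  apply: (@le_lt_trans _ _ (\sum_(v : letter d) y)).
    apply: ler_sum => v _.
    have le : ratio_pow (1 + \sum_v T v) v <= y.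
      have [_ <-] := TP v; have /andP[v0 v1] := c_in01 v.
      apply: ger_powR; first by rewrite v0 ltW.
      rewrite (bigD1 v)//= addrCA lerDl addr_ge0// sumr_ge0// => w _.
      by case: (TP w) => /ltW.
    apply: le_trans le; rewrite ler_pdivrMr ?addr_gt0 ?ratio_pow_gt0//.
    have x0 := ltW (ratio_pow_gt0 (1 + \sum_v T v) v).
    by rewrite ler_peMr// lerDl.
  rewrite sumr_const card_letter -mulr_natr /y -(ltr_pM2r (x := (d * 2)%:R + 1)).
    by rewrite mulrAC mulVf ?mul1r ?ltrDl// gt_eqF// ltr_pwDr// ler0n.
  by rewrite ltr_pwDr// ler0n.
have up := exponent_le (ltW t1_gt0) t1_fin.
have fin : exponent_of_convergence Phi setT \is a fin_num.
  rewrite fin_numE; apply/andP; split; apply/eqP => E.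
    by move: low; rewrite E leeNy_eq.
  by move: up; rewrite E leye_eq.
exists (fine (exponent_of_convergence Phi setT)); last by rewrite fineK.
by rewrite (lt_le_trans t0_gt0)// -lee_fin fineK.
Qed.

Variable N : normal_subgroup (free_group d).

Let p := quotient_proj N.
Let pM g h : p (g * h)%g = (p g * p h)%g.
Proof. by symmetry; exact: quotient_mulE. Qed.
Let p_surj y : exists g, p g = y.
Proof. by elim/quotient_projW: y => g; exists g. Qed.

Let kernelE : [set g | p g = 1%g] = N.
Proof. by apply/seteqP; split=> g /quotient_proj_eq1. Qed.

(** Convergence of the series of N at t makes the killing rate nonnegative right
    after t, hence positive later on, where the series of F_d converges. *)
Lemma exponent_eq_of_amenable : amenable R (quotient_group N) ->
  exponent_of_convergence Phi setT = exponent_of_convergence Phi N.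
Proof.
move=> am; apply/eqP; rewrite eq_le; apply/andP; split; last first.
  exact: exponent_subset.
apply: le_ereal_inf_tmp => _ [t [t0 fin] <-].
apply/lee_addgt0Pr => e e0; rewrite -EFinD.
apply: exponent_le; first by rewrite addr_ge0 // ltW.
have e2 : 0 < e / 2 by rewrite divr_gt0.
have t1 : 0 < t + e / 2 by rewrite ltr_wpDl.
apply/poincareT_lty; first by rewrite ltr_wpDl.
apply: (@le_lt_trans _ _ (killing (ratio_pow (t + e / 2)))); last first.
  by apply: killing_lt; lra.
apply: (amenable_killing_ge0 _ _ _ pM p_surj am).
- exact: ratio_pow_gt0.
- by move=> v; exact: ratio_pow_lt1.
- exact: ratio_pow_sym.
rewrite kernelE; under eq_esum do rewrite -word_ratio_pow.
by apply: le_lt_trans fin; apply: poincare_le; lra.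
Qed.

(** The gain eps that [kernel_growth] allows is fixed before t, so that t can be
    taken within eps / 2 of delta: with eta <= eps, convergence of the boosted
    series at t = delta + eta / 2 implies convergence of the series of N at
    delta - eta / 2. *)
Lemma amenable_of_exponent_eq :
  exponent_of_convergence Phi setT = exponent_of_convergence Phi N ->
  amenable R (quotient_group N).
Proof.
have [delta delta0 deltaE] := exponentT_fin_pos; rewrite deltaE => deltaNE.
apply: (@amenable_of_almost_invariant R _ _ (fun v : letter d => p (gen v))).
  exact: (hom_gen_ind pM p_surj).
move=> e e0; apply: contrapT => no_f.
have gap (u : quotient_group N -> R) : (energy u < +oo)%E ->
    (e%:E * energy u <= dirichlet (fun v : letter d => p (gen v)) u)%E.
  by move=> uf; rewrite leNgt; apply/negP => lt_e; apply: no_f; exists u.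
(* A lower bound for the jump rates at every t <= delta + 1. *)
pose kap := cmin `^ (delta + 1).
have kap0 : 0 < kap by rewrite powR_gt0; case/andP: cmin_in01.
pose theta := 1 + kap * e / 4.
have theta1 : 1 < theta by rewrite ltrDl divr_gt0// mulr_gt0.
have [eps eps0 epsE] : exists2 eps, 0 < eps & cmin `^ eps = theta^-1.
  apply: powR_onto => //; rewrite invr_gt0 invf_lt1 ?theta1 ?andbT; exact: lt_trans theta1.
pose eta := Num.min (Num.min eps delta) 1.
have eta0 : 0 < eta by rewrite !lt_min eps0 delta0 ltr01.
have [eta_eps eta_delta eta1] : [/\ eta <= eps, eta <= delta & eta <= 1].
  by rewrite /eta !ge_min !lexx ?orbT.
pose t := delta + eta / 2.
have t_gt0 : 0 < t by rewrite /t; lra.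
have fin1 : (mass (ratio_pow t) (fun=> 1%R) < +oo)%E.
  by rewrite -poincareT; apply: exponent_lt_poincare; rewrite deltaE lte_fin /t; lra.
have kap_le v : kap <= jump (ratio_pow t) v.
  apply: le_trans (le_jump (ratio_pow_gt0 t) (fun v => ratio_pow_lt1 v t_gt0) v).
  apply: (@le_trans _ _ (cmin `^ t)).
    have /andP[m0 m1] := cmin_in01; apply: ger_powR; first by rewrite m0 ltW.
    by rewrite /t; lra.
  have /andP[m0 m1] := cmin_in01; have /andP[v0 v1] := c_in01 v.
  by apply: (ge0_ler_powR (ltW t_gt0)); rewrite ?nnegrE ?cmin_le ?(ltW m0) ?(ltW v0).
have := kernel_growth (ratio_pow_gt0 t) (fun v => ratio_pow_lt1 v t_gt0)
  (ratio_pow_sym t) pM kap0 kap_le e0 gap fin1.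
rewrite -/theta kernelE => finN.
have : (poincare N (t - eta) < +oo)%E.
  apply: le_lt_trans finN; apply: le_esum => g _; rewrite lee_fin.
  rewrite word_ratio_pow /weight; elim: (fg_word g) => [|v s IHs].
    by rewrite !big_nil mulr1.
  rewrite !big_cons /= exprS mulrACA ler_pM//.
  - exact/ltW/ratio_pow_gt0.
  - by apply: prodr_ge0 => w _; exact/ltW/ratio_pow_gt0.
  have /andP[v0 v1] := c_in01 v; have /andP[m0 m1] := cmin_in01.
  rewrite /ratio_pow powRB; last by rewrite (gt_eqF v0) implybT.
  rewrite mulrC ler_wpM2r ?powR_ge0// -[leRHS]invrK -epsE.
  rewrite lef_pV2 ?posrE ?powR_gt0//.
  apply: (@le_trans _ _ (cmin `^ eta)); first by apply: ger_powR => //; rewrite m0 ltW.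
  by apply: (ge0_ler_powR (ltW eta0)); rewrite ?nnegrE ?cmin_le ?(ltW m0) ?(ltW v0).
move=> /(@exponent_le N (t - eta)); rewrite -deltaNE lee_fin /t => le.
have : delta <= delta + eta / 2 - eta by apply: le; lra.
lra.
Qed.

End Exponents.

Theorem theorem1p1 (R : realType) (d : nat) (hd : (2 <= d)%N)
    (Phi : linear_gdms R d) (hPhi : symmetric_gdms Phi)
    (N : normal_subgroup (free_group d)) :
  exponent_of_convergence Phi [set: free_group d]%classic =
    exponent_of_convergence Phi N
  <-> amenable R (quotient_group N).
Proof.
split; first exact: amenable_of_exponent_eq.
exact: exponent_eq_of_amenable.
Qed.
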